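(* Let $\mathcal{C}$ be an effectively compact, effectively orthogonal class of probability measures on a constructive metric space $X$. Let $\mathbf{t}_{\mathcal{C}}(x)$ be a universal $\mathcal{C}$-test, $s(x,P)$ a test-separator for $\mathcal{C}$, and $\mathbf{t}(x,P)$ a universal uniform test. Then $\mathbf{t}(x,P)\doteq\max(\mathbf{t}_{\mathcal{C}}(x),s(x,P))$ for all $P\in\mathcal{C}$ and all $x\in X$, i.e. the two sides are within bounded multiplicative constants of each other.
   Context: A constructive metric space $(X,d,D,\alpha)$ is a complete separable metric space with a numbered dense countable set $D$ on which $d$ is uniformly computable; basic balls have centres in $D$ and rational radii. $\mathcal{M}(X)$ (probability measures, Prokhorov metric, dense set of rational finitely supported measures on $D$) is a constructive metric space; $\mathcal{C}\subseteq\mathcal{M}(X)$ is effectively compact if compact and its finite coverings by basic balls form an enumerable set. Lower semicomputable functions (on $X$ or on $X\times\mathcal{M}(X)$) into $[0,\infty]$: each superlevel set $\{f>r\}$, $r$ rational, is a union of an enumerable family of basic balls (resp. products of basic balls), uniformly in $r$. A $\mathcal{C}$-test is a lower semicomputable $t:X\to[0,\infty]$ with $\int t\,dP\le1$ for all $P\in\mathcal{C}$; a uniform test is a lower semicomputable $t(x,P)\ge0$ with $\int t(x,P)\,dP(x)\le1$ for all $P\in\mathcal{M}(X)$; universal means maximal up to a multiplicative constant. $\mathrm{Randoms}(P)=\{x:\mathbf{t}(x,P)<\infty\}$; $\mathcal{C}$ is effectively orthogonal if $\mathrm{Randoms}(P)\cap\mathrm{Randoms}(Q)=\varnothing$ for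 distinct $P,Q\in\mathcal{C}$. A test-separator for $\mathcal{C}$ is a lower semicomputable $s:X\times\mathcal{M}(X)\to[0,\infty]$ with $\int s(x,P)\,dP(x)\le1$ for all $P$ such that for all distinct $P,Q\in\mathcal{C}$ and every $x$ at least one of $s(x,P),s(x,Q)$ is infinite. *)

(* Defs.v *)
From HB Require Import structures.
From mathcomp Require Import all_boot all_order all_algebra.
From mathcomp Require Import all_classical all_reals all_analysis.
From mathcomp Require Import giry.

Set Implicit Arguments.
Unset Strict Implicit.
Unset Printing Implicit Defensive.

Import Order.TTheory GRing.Theory Num.Theory.
Local Open Scope classical_set_scope.
Local Open Scope ring_scope.

(* Kleene's schemes.  Arities are not tracked: a function is applied to a list
   of arguments and a missing argument reads as 0, so on lists of length n the
   functions below are the n-ary partial recursive ones. *)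
Inductive recfun : Type :=
| RZero
| RSucc
| RProj of nat
| RComp (m : nat) of recfun & ('I_m -> recfun)
| RPrec of recfun & recfun
| RMin of recfun.

Fixpoint prec_graph (F G : seq nat -> nat -> Prop) (v : seq nat) (k y : nat) :
    Prop :=
  if k is k'.+1 then
    exists2 z : nat, prec_graph F G v k' z & G [:: k', z & v] y
  else F v y.

(* [reval f v y]: the computation of f on the arguments v halts with value y. *)
Fixpoint reval (f : recfun) (v : seq nat) (y : nat) : Prop :=
  match f with
  | RZero => y = 0%N
  | RSucc => y = (nth 0%N v 0).+1
  | RProj i => y = nth 0%N v i
  | RComp m g h => exists2 w : m.-tuple nat,
      (forall i : 'I_m, reval (h i) v (tnth w i)) & reval g w y
  | RPrec g h => prec_graph (reval g) (reval h) (behead v) (nth 0%N v 0) y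
  | RMin g => reval g (y :: v) 0 /\
      forall z : nat, (z < y)%N -> exists k : nat, reval g (z :: v) k.+1
  end.

(* Finite sequences of naturals are coded by the bijection CodeSeq.code. *)
Definition enumerable (A : set (seq nat)) : Prop :=
  exists f : recfun, forall s : seq nat,
    A s <-> exists k : nat, reval f [:: k] (CodeSeq.code s).

Definition entry (n i : nat) : nat := nth 0%N (CodeSeq.decode n) i.

Definition rat_of (n : nat) : rat :=
  ((entry n 0)%:R - (entry n 1)%:R) / (entry n 2).+1%:R.

Definition posrat_of (n : nat) : rat :=
  (entry n 0).+1%:R / (entry n 1).+1%:R.

Definition computable_real2 (R : realType) (u : nat -> nat -> R) : Prop :=
  exists f : recfun, forall i j k : nat, exists2 n : nat,
    reval f [:: i; j; k] n & `|u i j - ratr (rat_of n)| <= 2 ^- k.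

(* The numbering [ideal_point] need not be injective; D is its range.  Nonemptiness
   of X comes with the library's complete uniform spaces. *)
HB.mixin Record isConstructive (R : realType) X & Complete X & Metric R X := {
  ideal_point : nat -> X ;
  ideal_point_dense : dense (range ideal_point) ;
  ideal_point_mdist :
    computable_real2 (fun i j : nat => @mdist R X (ideal_point i) (ideal_point j))
}.

#[short(type="constructiveMetricType")]
HB.structure Definition ConstructiveMetric (R : realType) :=
  { X of Complete X & Metric R X & isConstructive R X }.

(* The ball with centre [a i] and radius q coded by n = <i, q>. *)
Definition basic_ball (R : realType) (T : pseudoMetricType R) (a : nat -> T)
    (n : nat) : set T :=
  ball (a (entry n 0)) (ratr (posrat_of (entry n 1))).

Definition borel (R : realType) (X : constructiveMetricType R) :=
  g_sigma_algebraType (@open X).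

Definition pmeas (R : realType) (X : constructiveMetricType R) : Type :=
  probability (borel X) R.

Section prokhorov.
Context (R : realType) (X : constructiveMetricType R).
Implicit Types (P Q : pmeas X) (A : set X) (e : R).

Definition fattening A e : set X :=
  [set x | exists2 y : X, A y & mdist y x < e].

Definition prokhorov_le P Q e : Prop :=
  forall A : set (borel X), measurable A ->
    (P A <= Q (fattening A e) + e%:E)%E /\ (Q A <= P (fattening A e) + e%:E)%E.

Definition prokhorov P Q : R := inf [set e | 0 < e /\ prokhorov_le P Q e].

Lemma fattening_open A e : open (fattening A e).
Proof.
rewrite openE => x [y Ay yx]; apply/nbhs_ballP.
exists (e - mdist y x) => /=; first by rewrite subr_gt0.
move=> z; rewrite ballEmdist /= ltrBrDl => xz.
by exists y => //; exact: le_lt_trans (metric_triangle y x z) xz.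
Qed.

Lemma fattening_measurable A e :
  measurable (fattening A e : set (borel X)).
Proof. by apply: sub_sigma_algebra; exact: fattening_open. Qed.

Lemma sub_fattening A e : 0 < e -> A `<=` fattening A e.
Proof. by move=> e0 x Ax; exists x => //; rewrite mdistxx. Qed.

Lemma prokhorov_le_refl P e : 0 < e -> prokhorov_le P P e.
Proof.
move=> e0 A mA; suff h : (P A <= P (fattening A e) + e%:E)%E by [].
apply: (@le_trans _ _ (P (fattening A e))).
  apply: le_measure; rewrite ?inE //; first exact: fattening_measurable.
  exact: sub_fattening.
by rewrite leeDl// lee_fin ltW.
Qed.

Lemma prokhorov_le_trans P Q (S : pmeas X) e1 e2 :
  prokhorov_le P Q e1 -> prokhorov_le Q S e2 -> prokhorov_le P S (e1 + e2).
Proof.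
have sub A d1 d2 : fattening (fattening A d1) d2 `<=` fattening A (d1 + d2).
  move=> x [y [z Az zy] yx]; exists z => //.
  by apply: (le_lt_trans (metric_triangle z y x)); rewrite ltrD.
have step (P1 Q1 S1 : pmeas X) A d1 d2 :
    (P1 A <= Q1 (fattening A d1) + d1%:E)%E ->
    (Q1 (fattening A d1) <= S1 (fattening (fattening A d1) d2) + d2%:E)%E ->
    (P1 A <= S1 (fattening A (d1 + d2)%R) + (d1 + d2)%:E)%E.
  move=> h1 h2; apply: (le_trans h1).
  rewrite EFinD (addeC d1%:E) addeA leeD2r//; apply: (le_trans h2).
  rewrite leeD2r//; apply: le_measure; rewrite ?inE;
    [exact: fattening_measurable|exact: fattening_measurable|exact: sub].
move=> PQ QS A mA; split.
  apply: (step P Q S); first by have [] := PQ _ mA.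
  by have [] := QS _ (fattening_measurable A e1).
rewrite (addrC e1 e2); apply: (step S Q P); first by have [] := QS _ mA.
by have [] := PQ _ (fattening_measurable A e2).
Qed.

Lemma prokhorov_le_sym P Q e : prokhorov_le P Q e -> prokhorov_le Q P e.
Proof. by move=> PQ A mA; have [] := PQ A mA. Qed.

Lemma prokhorov_inf P Q :
  has_inf [set e | 0 < e /\ prokhorov_le P Q e].
Proof.
split; last by exists 0 => e [/ltW].
exists 1; split=> // A mA.
have h (P1 Q1 : pmeas X) B : measurable (B : set (borel X)) ->
    (P1 B <= Q1 (fattening B 1) + 1%:E)%E.
  move=> mB; apply: (le_trans (probability_le1 P1 mB)).
  by rewrite leeDr.
by split; exact: h.
Qed.

Lemma prokhorov_ltP P Q e : prokhorov P Q < e <->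
  exists2 d, 0 < d < e & prokhorov_le P Q d.
Proof.
split=> [PQe|[d /andP[d0 de] PQ]].
  have := inf_adherent (eps := e - prokhorov P Q) _ (prokhorov_inf P Q).
  rewrite subr_gt0 => /(_ PQe)[d [d0 PQ]]; rewrite addrC subrK => de.
  by exists d => //; rewrite d0 de.
apply: le_lt_trans de; apply: ge_inf => //.
by have [] := prokhorov_inf P Q.
Qed.

Definition prokhorov_ball P e : set (pmeas X) := [set Q | prokhorov P Q < e].

Let pent : set_system (pmeas X * pmeas X) := entourage_ prokhorov_ball.

Let pnbhs P : set_system (pmeas X) := nbhs_ pent P.

Let pnbhsE : pnbhs = nbhs_ pent. Proof. by []. Qed.

Let pball_center P e : 0 < e -> prokhorov_ball P e P.
Proof.
move=> e0; apply/prokhorov_ltP; exists (e / 2).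
  by rewrite divr_gt0//= ltr_pdivrMr// ltr_pMr// ltr1n.
by apply: prokhorov_le_refl; rewrite divr_gt0.
Qed.

Let pball_sym P Q e : prokhorov_ball P e Q -> prokhorov_ball Q e P.
Proof.
move=> /prokhorov_ltP[d de /prokhorov_le_sym PQ].
by apply/prokhorov_ltP; exists d.
Qed.

Let pball_triangle P Q (S : pmeas X) e1 e2 :
  prokhorov_ball P e1 Q -> prokhorov_ball Q e2 S ->
  prokhorov_ball P (e1 + e2) S.
Proof.
move=> /prokhorov_ltP[d1 /andP[d10 d1e] PQ] /prokhorov_ltP[d2 /andP[d20 d2e] QS].
apply/prokhorov_ltP; exists (d1 + d2); last exact: prokhorov_le_trans PQ QS.
by rewrite addr_gt0//= ltrD.
Qed.

Let pentE : pent = entourage_ prokhorov_ball. Proof. by []. Qed.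

(* The library's measures are functions on all sets, so two of them that agree
   on Borel sets may still differ; such pairs are at Prokhorov distance 0 and
   the structure is only pseudometric.  Hence "distinct measures" is rendered
   below as [~ measure_eq P Q]. *)
HB.instance Definition _ := Choice.on (pmeas X).
HB.instance Definition _ := hasNbhs.Build (pmeas X) pnbhs.
HB.instance Definition _ := @Nbhs_isPseudoMetric.Build R (pmeas X)
  pent pnbhsE prokhorov_ball pball_center pball_sym pball_triangle pentE.

(* The numbering of the finitely supported measures with rational weights: n
   codes a list of pairs (i, w), which stands for the measure
   (sum of w * delta_(ideal_point i)) / (sum of w); when all w are 0 the value is
   delta_(ideal_point 0). *)
Definition ideal_measure (n : nat) : pmeas X :=
  mnormalize
    (msum (fun j : nat => mscale ((entry (entry n j) 1)%:R%:nng : {nonneg R})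
                            (dirac (ideal_point (entry (entry n j) 0) : borel X)))
          (size (CodeSeq.decode n)))
    (dirac (ideal_point 0 : borel X)).

End prokhorov.

Section tests.
Context (R : realType) (X : constructiveMetricType R).
Implicit Types (C : set (pmeas X)) (P Q : pmeas X).
Local Open Scope ereal_scope.

Definition effectively_compact C : Prop :=
  compact C /\
  enumerable [set s : seq nat |
    C `<=` \bigcup_(n in [set` s]) basic_ball (@ideal_measure R X) n].

Definition lower_semicomputable (f : X -> \bar R) : Prop :=
  (forall x : X, 0 <= f x) /\
  exists2 W : set (seq nat), enumerable W &
    forall r : nat,
      [set x | (ratr (rat_of r))%:E < f x] =
      \bigcup_(n in [set n | W [:: r; n]]) basic_ball (@ideal_point R X) n.

Definition lower_semicomputable2 (f : X -> pmeas X -> \bar R) : Prop :=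
  (forall (x : X) (P : pmeas X), 0 <= f x P) /\
  exists2 W : set (seq nat), enumerable W &
    forall r : nat,
      [set xP | (ratr (rat_of r))%:E < f xP.1 xP.2] =
      \bigcup_(nm in [set nm | W [:: r; nm.1; nm.2]])
        (basic_ball (@ideal_point R X) nm.1 `*` basic_ball (@ideal_measure R X) nm.2).

Definition class_test C (t : X -> \bar R) : Prop :=
  lower_semicomputable t /\
  forall P : pmeas X, C P -> \int[P]_x (t : borel X -> \bar R) x <= 1.

Definition universal_class_test C (t : X -> \bar R) : Prop :=
  class_test C t /\
  forall t' : X -> \bar R, class_test C t' ->
    exists2 c : R, (0 < c)%R & forall x : X, t' x <= c%:E * t x.

Definition uniform_test (t : X -> pmeas X -> \bar R) : Prop :=
  lower_semicomputable2 t /\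
  forall P : pmeas X, \int[P]_x (t : borel X -> pmeas X -> \bar R) x P <= 1.

Definition universal_uniform_test (t : X -> pmeas X -> \bar R) : Prop :=
  uniform_test t /\
  forall t' : X -> pmeas X -> \bar R, uniform_test t' ->
    exists2 c : R, (0 < c)%R &
      forall (x : X) (P : pmeas X), t' x P <= c%:E * t x P.

Definition Randoms (t : X -> pmeas X -> \bar R) P : set X :=
  [set x | t x P < +oo].

Definition effectively_orthogonal (t : X -> pmeas X -> \bar R) C : Prop :=
  forall P Q : pmeas X, C P -> C Q -> ~ measure_eq P Q ->
    Randoms t P `&` Randoms t Q = set0.

Definition test_separator C (s : X -> pmeas X -> \bar R) : Prop :=
  [/\ lower_semicomputable2 s,
      forall P : pmeas X, \int[P]_x (s : borel X -> pmeas X -> \bar R) x P <= 1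
    & forall P Q : pmeas X, C P -> C Q -> ~ measure_eq P Q ->
        forall x : X, s x P = +oo \/ s x Q = +oo].

End tests.

(* Main.v *)
(* Upper bound.  The function g = 1/2 inf_(Q in C) max(t(x,Q), s(x,Q)) is lower
   semicomputable, because C is effectively compact, so it is a C-test.  If s(x,P)
   is finite then s(x,Q) is infinite for all Q in C other than P, hence g(x) is
   1/2 max(t(x,P), s(x,P)) and universality of tC bounds t(x,P).

   Lower bound.  The separator s is itself a uniform test.  For tC, let U_k be
   {tC > 2^k} and let A_(n,k) increase to U_k with n, where A_(n,k) is the union of
   the balls of U_k listed before stage n, shrunk by 2^-n.  For P in C,
   sum_(k < n) 2^k P(U_k) <= 2, and a finite computation with an ideal measure
   close to P certifies sum_(k < n) 2^k P(A_(n,k)) <= 4.  Taking the supremum of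
   the 2^k with x in A_(n,k) over the certified n only (the A_(n,k) increase with n,
   so the bound on the integral survives) gives a uniform test, up to a constant, which
   exceeds tC/16 on C.  Certificates exist for P in C since ideal measures are
   dense for the Prokhorov metric. *)
Require Import Defs.
From HB Require Import structures.
From mathcomp Require Import all_boot all_order all_algebra.
From mathcomp Require Import all_classical all_reals all_analysis.
From mathcomp Require Import measurable_realfun giry ring lra.

Set Implicit Arguments.
Unset Strict Implicit.
Unset Printing Implicit Defensive.

Import Order.TTheory GRing.Theory Num.Theory.
Local Open Scope classical_set_scope.
Local Open Scope ring_scope.

(** * Total recursive functions *)

Section total_recursive.
Local Open Scope nat_scope.

(** The obstacle in the lower bound: [tC] controls integrals only for measures in C, a uniform test
    must respect its bound at every P, and admitting a stage must be an enumerable, hence open,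
    condition on P. An upper bound on the mass of an open set is not open, since P(U) is only lower
    semicontinuous in P. The gap between A_(n,k) and U_k leaves room for one: a decidable property
    of ideal points holds near A_(n,k) and puts a whole neighbourhood inside U_k. So the mass of
    A_(n,k) under P, of the selected points under a nearby ideal measure, and of U_k under P compare
    up to the Prokhorov distance. That error is weighted by the sum of the 2^k, k < n, which is at
    most 2^n; at distance 2^-(n+2) each comparison costs at most 1, and 2 for P in C becomes 3 for
    the ideal measure and 4 for every measure in its ball.

    Enumerability is phrased with Kleene schemes. It is handled through [semidec], a decidable
    matrix under one unbounded number quantifier; closure under quantification over finite lists is
    what turns a finite covering of C into a certificate for the infimum. *)

Definition total_rec (F : seq nat -> nat) : Prop :=
  exists f, forall v, reval f v (F v).

Definition rcomp (g : recfun) (hs : seq recfun) : recfun :=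
  RComp g (fun i : 'I_(size hs) => nth RZero hs i).

Lemma reval_rcomp g hs v ws y : size ws = size hs ->
  (forall i, i < size hs -> reval (nth RZero hs i) v (nth 0 ws i)) ->
  reval g ws y -> reval (rcomp g hs) v y.
Proof.
move=> sz hsw gy.
have szw : size ws == size hs by apply/eqP.
exists (Tuple szw) => // i.
by rewrite (tnth_nth 0) /=; apply: hsw.
Qed.

Lemma total_rec_ext F G : F =1 G -> total_rec F -> total_rec G.
Proof. by move=> FG [f fF]; exists f => v; rewrite -FG. Qed.

Lemma total_rec_nth i : total_rec (fun v => nth 0 v i).
Proof. by exists (RProj i). Qed.

Lemma total_rec0 : total_rec (fun=> 0).
Proof. by exists RZero. Qed.

Lemma total_recS F : total_rec F -> total_rec (fun v => (F v).+1).
Proof.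
move=> [f fF]; exists (rcomp RSucc [:: f]) => v.
by apply: (@reval_rcomp _ _ _ [:: F v]) => // -[].
Qed.

Lemma total_rec_const c : total_rec (fun=> c).
Proof. by elim: c => [|c /total_recS//]; exact: total_rec0. Qed.

Lemma total_rec_comp1 G H :
  total_rec G -> total_rec H -> total_rec (fun v => G [:: H v]).
Proof.
move=> [g gG] [h hH]; exists (rcomp g [:: h]) => v.
by apply: (@reval_rcomp _ _ _ [:: H v]) => // -[].
Qed.

Lemma total_rec_comp2 G H1 H2 : total_rec G -> total_rec H1 -> total_rec H2 ->
  total_rec (fun v => G [:: H1 v; H2 v]).
Proof.
move=> [g gG] [h1 hH1] [h2 hH2]; exists (rcomp g [:: h1; h2]) => v.
by apply: (@reval_rcomp _ _ _ [:: H1 v; H2 v]) => // -[|[]].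
Qed.

Lemma total_rec_prec F G : total_rec F -> total_rec G ->
  total_rec (fun v => nat_rect (fun=> nat) (F (behead v))
    (fun k z => G [:: k, z & behead v]) (nth 0 v 0)).
Proof.
move=> [f fF] [g gG]; exists (RPrec f g) => v /=.
elim: (nth 0 v 0) => [|k IH] /=; first exact: fF.
by eexists; [exact: IH|exact: gG].
Qed.

(* The bijection of nat * nat with nat underlying CodeSeq: it satisfies
   code (x :: s) = (npair x (code s)).+1. *)
Definition npair (x y : nat) : nat := (2 ^ x * y.*2.+1).-1.

Lemma npairS x y : (npair x y).+1 = 2 ^ x * y.*2.+1.
Proof. by rewrite prednK// muln_gt0 expn_gt0. Qed.

Lemma code_cons x s : CodeSeq.code (x :: s) = (npair x (CodeSeq.code s)).+1.
Proof. by rewrite npairS. Qed.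

Definition nunpair (n : nat) : nat * nat :=
  (head 0 (CodeSeq.decode n.+1), CodeSeq.code (behead (CodeSeq.decode n.+1))).

Lemma npairK x y : nunpair (npair x y) = (x, y).
Proof.
have -> : npair x y = (CodeSeq.code (x :: CodeSeq.decode y)).-1.
  by rewrite code_cons CodeSeq.decodeK.
rewrite /nunpair prednK; last by rewrite code_cons.
by rewrite CodeSeq.codeK /= CodeSeq.decodeK.
Qed.

Lemma nunpairK n : npair (nunpair n).1 (nunpair n).2 = n.
Proof.
apply/succn_inj; have := CodeSeq.decodeK n.+1.
rewrite /nunpair; case: (CodeSeq.decode n.+1) => [//|x s].
by rewrite code_cons.
Qed.

Lemma total_rec_double : total_rec (fun v => (nth 0 v 0).*2).
Proof.
have := total_rec_prec total_rec0 (total_recS (total_recS (total_rec_nth 1))).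
apply: total_rec_ext => v /=.
by elim: (nth 0 v 0) => //= k ->; rewrite doubleS.
Qed.

Lemma total_rec_pred : total_rec (fun v => (nth 0 v 0).-1).
Proof.
have := total_rec_prec total_rec0 (total_rec_nth 0).
by apply: total_rec_ext => v /=; case: (nth 0 v 0).
Qed.

Lemma total_rec_negodd : total_rec (fun v => ~~ odd (nth 0 v 0)).
Proof.
(* [h] tests for 0; applying it k times to 1 gives the evenness bit of k. *)
have h := total_rec_prec (total_rec_const 1) (total_rec_const 0).
have := total_rec_prec (total_rec_const 1)
  (total_rec_comp1 h (total_rec_nth 1)).
apply: total_rec_ext => v /=.
by elim: (nth 0 v 0) => //= k ->; case: (odd k).
Qed.

Lemma total_rec_half : total_rec (fun v => (nth 0 v 0)./2).
Proof.
(* The half grows at [k.+1] exactly when k is odd, that is, when the evenness bit read as first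
   argument is 0. *)
have hif : total_rec (fun v => if nth 0 v 0 is 0 then (nth 0 v 1).+1 else nth 0 v 1).
  have := total_rec_prec (total_recS (total_rec_nth 0)) (total_rec_nth 2).
  by apply: total_rec_ext => -[|[|x] [|y v]].
have := total_rec_prec total_rec0 (total_rec_comp2 hif
  (total_rec_comp1 total_rec_negodd (total_rec_nth 0)) (total_rec_nth 1)).
apply: total_rec_ext => v /=.
elim: (nth 0 v 0) => //= k ->.
by rewrite uphalf_half; case: (odd k).
Qed.

Lemma total_rec_iter F : total_rec F ->
  total_rec (fun v => iter (nth 0 v 0) (fun x => F [:: x]) (nth 0 v 1)).
Proof.
move=> hF; have := total_rec_prec (total_rec_nth 0)
  (total_rec_comp1 hF (total_rec_nth 1)).
apply: total_rec_ext => v /=.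
rewrite nth_behead; elim: (nth 0 v 0) => //= k -> //.
Qed.

Lemma total_rec_npair : total_rec (fun v => npair (nth 0 v 0) (nth 0 v 1)).
Proof.
have := total_rec_comp1 total_rec_pred (total_rec_comp2
  (total_rec_iter total_rec_double) (total_rec_nth 0)
  (total_recS (total_rec_comp1 total_rec_double (total_rec_nth 1)))).
apply: total_rec_ext => v /=; rewrite /npair; congr predn.
elim: (nth 0 v 0) => [|k IH] /=; first by rewrite mul1n.
by rewrite IH expnS -mulnA mul2n.
Qed.

Lemma iter_half_npair k x y : k <= x ->
  iter k half (npair x y).+1 = 2 ^ (x - k) * y.*2.+1.
Proof.
rewrite npairS; elim: k => [|k IH] kx; first by rewrite subn0.
rewrite iterS IH; last exact: ltnW.
by rewrite -(subnSK kx) expnS -mulnA mul2n doubleK.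
Qed.

(** The successor of [npair x y] is 2^x times an odd number, so x is the least number of halvings
    that gives an odd result; [RMin] finds it. *)
Lemma total_rec_unpair1 : total_rec (fun v => (nunpair (nth 0 v 0)).1).
Proof.
have [f fF] := total_rec_comp1 total_rec_negodd (total_rec_comp2
  (total_rec_iter total_rec_half) (total_rec_nth 0)
  (total_recS (total_rec_nth 1))).
exists (RMin f) => v.
set n := nth 0 v 0; have En := nunpairK n.
set x := (nunpair n).1 in En *; set y := (nunpair n).2 in En *.
split.
  have := fF (x :: v); rewrite /= -/n -En iter_half_npair//.
  by rewrite subnn mul1n /= odd_double.
move=> z zx; exists 0; have := fF (z :: v).
rewrite /= -/n -En iter_half_npair; last exact: ltnW.
by rewrite -(subnSK zx) expnS -mulnA mul2n odd_double.
Qed.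

Lemma total_rec_unpair2 : total_rec (fun v => (nunpair (nth 0 v 0)).2).
Proof.
have := total_rec_comp1 total_rec_half (total_rec_comp2
  (total_rec_iter total_rec_half) total_rec_unpair1
  (total_recS (total_rec_nth 0))).
apply: total_rec_ext => v /=.
set n := nth 0 v 0; have En := nunpairK n.
rewrite -[in (n.+1)]En iter_half_npair// subnn mul1n /=.
by rewrite uphalf_double.
Qed.

End total_recursive.

Arguments npair : simpl never.
Arguments nunpair : simpl never.

(** * Computable functions between coded types *)

(** A bijection with the naturals, not only an injection: by [decK], decoding is computed by the
    identity on codes, and a search over all numbers is a search over all of T. *)
Class encodable (T : Type) := Encodable {
  enc : T -> nat;
  dec : nat -> T;
  encK : cancel enc dec;
  decK : cancel dec enc }.

#[export] Instance encodable_nat : encodable nat := @Encodable nat id id (frefl _) (frefl _).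

Section encodable_prod.
Context (T U : Type) {eT : encodable T} {eU : encodable U}.
Let penc (p : T * U) := npair (enc p.1) (enc p.2).
Let pdec n := (dec (nunpair n).1 : T, dec (nunpair n).2 : U).
Let pencK : cancel penc pdec.
Proof. by move=> [a b]; rewrite /pdec /penc npairK /= !encK. Qed.
Let pdecK : cancel pdec penc.
Proof. by move=> n; rewrite /pdec /penc /= !decK nunpairK. Qed.
#[export] Instance encodable_prod : encodable (T * U) := Encodable pencK pdecK.
End encodable_prod.
#[export] Existing Instance encodable_prod.

Section encodable_seq.
Context (T : Type) {eT : encodable T}.
Let senc (s : seq T) := CodeSeq.code (map enc s).
Let sdec n : seq T := map dec (CodeSeq.decode n).
Let sencK : cancel senc sdec.
Proof. by move=> s; rewrite /sdec /senc CodeSeq.codeK mapK//; exact: encK. Qed.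
Let sdecK : cancel sdec senc.
Proof.
by move=> n; rewrite /sdec /senc mapK ?CodeSeq.decodeK//; exact: decK.
Qed.
#[export] Instance encodable_seq : encodable (seq T) := Encodable sencK sdecK.
End encodable_seq.
#[export] Existing Instance encodable_seq.

Lemma enc_cons (T : Type) {eT : encodable T} (x : T) (s : seq T) :
  enc (x :: s) = (npair (enc x) (enc s)).+1.
Proof. exact: code_cons. Qed.

Section computable.
Local Open Scope nat_scope.

Definition computable {T U} {eT : encodable T} {eU : encodable U} (F : T -> U) :=
  exists f, forall a, reval f [:: enc a] (enc (F a)).

Definition computableb {T} {eT : encodable T} (p : T -> bool) :=
  computable (fun t => nat_of_bool (p t)).

Context (T U V : Type) {eT : encodable T} {eU : encodable U} {eV : encodable V}.

Lemma computable_ext (F G : T -> U) : F =1 G -> computable F -> computable G.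
Proof. by move=> FG [f fF]; exists f => a; rewrite -FG. Qed.

Lemma computable_rec (F : T -> U) (R : seq nat -> nat) :
  total_rec R -> (forall a, R [:: enc a] = enc (F a)) -> computable F.
Proof. by move=> [f fR] RF; exists f => a; rewrite -RF. Qed.

Lemma computable_id : computable (@id T).
Proof. by exists (RProj 0). Qed.

Lemma computable_const (c : U) : computable (fun _ : T => c).
Proof. exact: (computable_rec (total_rec_const (enc c))). Qed.

Lemma computable_comp (G : U -> V) (F : T -> U) :
  computable G -> computable F -> computable (fun a => G (F a)).
Proof.
move=> [g gG] [f fF]; exists (rcomp g [:: f]) => v.
by apply: (@reval_rcomp _ _ _ [:: enc (F v)]) => // -[].
Qed.

Lemma computable_pair (F : T -> U) (G : T -> V) :
  computable F -> computable G -> computable (fun a => (F a, G a)).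
Proof.
move=> [f fF] [g gG]; have [p pP] := total_rec_npair.
exists (rcomp p [:: f; g]) => v.
apply: (@reval_rcomp _ _ _ [:: enc (F v); enc (G v)]) => [//|[|[]]//|].
exact: pP.
Qed.

End computable.

Arguments computable_id {T eT}.

Section computable_proj.
Context (T U V : Type) {eT : encodable T} {eU : encodable U} {eV : encodable V}.

Lemma computable_fst (F : T -> U * V) :
  computable F -> computable (fun a => (F a).1).
Proof.
apply: (computable_comp (G := fun p : U * V => p.1)).
apply: (computable_rec total_rec_unpair1) => -[a b].
exact: (congr1 fst (npairK (enc a) (enc b))).
Qed.

Lemma computable_snd (F : T -> U * V) :
  computable F -> computable (fun a => (F a).2).
Proof.
apply: (computable_comp (G := fun p : U * V => p.2)).
apply: (computable_rec total_rec_unpair2) => -[a b].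
exact: (congr1 snd (npairK (enc a) (enc b))).
Qed.

End computable_proj.

Section computable_natrec.
Local Open Scope nat_scope.
Context (T B : Type) {eT : encodable T} {eB : encodable B}.

Lemma computable_natrec (N : T -> nat) (F : T -> B) (G : T -> nat -> B -> B) :
  computable N -> computable F ->
  computable (fun p : T * (nat * B) => G p.1 p.2.1 p.2.2) ->
  computable (fun a => nat_rect (fun=> B) (F a) (G a) (N a)).
Proof.
move=> [n nN] [f fF] [g gG]; have [p pP] := total_rec_npair.
(* [RPrec] supplies the arguments k, z, a as a list; [g'] repacks them as the code of [(a, (k, z))],
   which g expects. *)
pose g' := rcomp g [:: rcomp p [:: RProj 2; rcomp p [:: RProj 0; RProj 1]]].
exists (rcomp (RPrec f g') [:: n; RProj 0]) => a.
apply: (@reval_rcomp _ _ _ [:: N a; enc a]) => [//|[|[]]//|].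
rewrite [reval _ _ _]/(prec_graph (reval f) (reval g') [:: enc a] (N a) _).
elim: (N a) => [|k IH]; first exact: fF.
eexists; first exact: IH.
set z := nat_rect _ _ _ k.
change (reval g' [:: k; enc z; enc a] (enc (G a k z))).
apply: (@reval_rcomp _ _ _ [:: enc (a, (k, z))]) => //.
move=> [|//] _; apply: (@reval_rcomp _ _ _ [:: enc a; enc (k, z)]) => //.
  move=> [//|[|//]] _; apply: (@reval_rcomp _ _ _ [:: k; enc z]) => //.
  by move=> [|[]].
Qed.

Lemma computable_if (p : T -> bool) (F G : T -> B) :
  computableb p -> computable F -> computable G ->
  computable (fun a => if p a then F a else G a).
Proof.
move=> cp cF cG.
apply: (@computable_ext _ _ _ _ (fun a => nat_rect _ (G a) (fun _ _ => F a)
  (nat_of_bool (p a)))).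
  by move=> a /=; case: (p a).
apply: (computable_natrec (G := fun a _ _ => F a)) => //.
exact/(computable_comp cF)/computable_fst/computable_id.
Qed.

End computable_natrec.

Section computable_succ_pred.
Local Open Scope nat_scope.
Context (T : Type) {eT : encodable T}.
Implicit Types (F G : T -> nat) (p q : T -> bool).

Lemma computable_succ F : computable F -> computable (fun a => (F a).+1).
Proof.
by apply: (computable_comp (G := S)); apply: (computable_rec (total_recS (total_rec_nth 0))).
Qed.

Lemma computable_pred F : computable F -> computable (fun a => (F a).-1).
Proof.
by apply: (computable_comp (G := predn)); apply: (computable_rec total_rec_pred).
Qed.

Lemma computable_nunpair1 F : computable F -> computable (fun a => (nunpair (F a)).1).
Proof.
apply: (computable_comp (G := fun n => (nunpair n).1)).
exact: (computable_rec total_rec_unpair1).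
Qed.

Lemma computable_nunpair2 F : computable F -> computable (fun a => (nunpair (F a)).2).
Proof.
apply: (computable_comp (G := fun n => (nunpair n).2)).
exact: (computable_rec total_rec_unpair2).
Qed.

End computable_succ_pred.

Section computable_add_sub.
Local Open Scope nat_scope.
Context (T : Type) {eT : encodable T}.
Implicit Types (F G : T -> nat) (p q : T -> bool).

Let acc : computable (fun p : T * (nat * nat) => p.2.2).
Proof. exact/computable_snd/computable_snd/computable_id. Qed.

Lemma computable_add F G : computable F -> computable G ->
  computable (fun a => F a + G a).
Proof.
move=> cF cG; have := computable_natrec (G := fun _ _ z => z.+1) cG cF (computable_succ acc).
by apply: computable_ext => a; elim: (G a) => [|k /= ->]; rewrite ?addn0 ?addnS.
Qed.

Lemma computable_sub F G : computable F -> computable G ->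
  computable (fun a => F a - G a).
Proof.
move=> cF cG; have := computable_natrec (G := fun _ _ z => z.-1) cG cF (computable_pred acc).
by apply: computable_ext => a; elim: (G a) => [|k /= ->]; rewrite ?subn0 ?subnS.
Qed.

End computable_add_sub.

Section computable_mul_leq.
Local Open Scope nat_scope.
Context (T : Type) {eT : encodable T}.
Implicit Types (F G : T -> nat) (p q : T -> bool).

Let arg U (eU : encodable U) (F : T -> U) :
  computable F -> computable (fun p : T * (nat * nat) => F p.1).
Proof. by move=> cF; exact/(computable_comp cF)/computable_fst/computable_id. Qed.

Let acc : computable (fun p : T * (nat * nat) => p.2.2).
Proof. exact/computable_snd/computable_snd/computable_id. Qed.

Lemma computable_mul F G : computable F -> computable G ->
  computable (fun a => F a * G a).
Proof.
move=> cF cG; have := computable_natrec (G := fun a _ z => F a + z) cG (computable_const 0)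
  (computable_add (arg cF) acc).
by apply: computable_ext => a; elim: (G a) => [|k /= ->]; rewrite ?muln0 ?mulnS.
Qed.

Lemma computable_leq F G : computable F -> computable G ->
  computableb (fun a => F a <= G a).
Proof.
move=> cF cG; have := computable_sub (computable_const 1) (computable_sub cF cG).
by apply: computable_ext => a; rewrite -subn_eq0; case: (F a - G a).
Qed.

Lemma computable_and p q : computableb p -> computableb q ->
  computableb (fun a => p a && q a).
Proof.
move=> cp cq; apply: computable_ext (computable_mul cp cq) => a.
by rewrite mulnb.
Qed.

Lemma computable_not p : computableb p -> computableb (fun a => ~~ p a).
Proof.
move=> cp; apply: computable_ext (computable_sub (computable_const 1) cp) => a.
by case: (p a).
Qed.

End computable_mul_leq.

Section computable_exp_eq.
Local Open Scope nat_scope.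
Context (T : Type) {eT : encodable T}.
Implicit Types (F G : T -> nat) (p q : T -> bool).

Lemma computable_exp F G : computable F -> computable G ->
  computable (fun a => F a ^ G a).
Proof.
move=> cF cG.
apply: (@computable_ext _ _ _ _ (fun a => nat_rect _ 1 (fun _ z => F a * z) (G a))).
  by move=> a; elim: (G a) => [|k /= ->]; rewrite ?expnS.
apply: (computable_natrec (G := fun a _ z => F a * z) cG (computable_const 1)).
apply: computable_mul; last exact/computable_snd/computable_snd/computable_id.
exact/(computable_comp cF)/computable_fst/computable_id.
Qed.

Lemma computable_or p q : computableb p -> computableb q ->
  computableb (fun a => p a || q a).
Proof.
move=> cp cq; have := computable_not (computable_and (computable_not cp) (computable_not cq)).
by apply: computable_ext => a; rewrite negb_and !negbK.
Qed.

Lemma computable_eqn F G : computable F -> computable G ->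
  computableb (fun a => F a == G a).
Proof.
move=> cF cG; have := computable_and (computable_leq cF cG) (computable_leq cG cF).
by apply: computable_ext => a; rewrite eqn_leq.
Qed.

Lemma computable_ltn F G : computable F -> computable G ->
  computableb (fun a => F a < G a).
Proof. by move=> cF cG; exact: computable_leq (computable_succ cF) cG. Qed.

End computable_exp_eq.

Section computable_bounded.
Local Open Scope nat_scope.
Context (T : Type) {eT : encodable T}.

Lemma computable_has_iota (p : T -> nat -> bool) (F : T -> nat) :
  computable F ->
  computableb (fun q : T * nat => p q.1 q.2) ->
  computableb (fun a => has (p a) (iota 0 (F a))).
Proof.
move=> cF cp; pose G a k z := nat_of_bool ((z != 0) || p a k).
apply: (@computable_ext _ _ _ _ (fun a => nat_rect _ 0 (G a) (F a))).
  move=> a; elim: (F a) => // k IH; rewrite [LHS]/= {}IH /G -[in RHS]addn1.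
  by rewrite iotaD has_cat /= orbF; case: (has _ _).
apply: (computable_natrec (G := G) cF (computable_const 0)).
apply: (computable_or (T := T * (nat * nat))).
  apply/computable_not/computable_eqn; last exact: computable_const.
  exact/computable_snd/computable_snd/computable_id.
apply: (computable_comp cp (F := fun q : T * (nat * nat) => (q.1, q.2.1))).
apply: computable_pair; first exact/computable_fst/computable_id.
exact/computable_fst/computable_snd/computable_id.
Qed.

Lemma computable_sum_iota (G : T -> nat -> nat) (F : T -> nat) :
  computable F ->
  computable (fun q : T * nat => G q.1 q.2) ->
  computable (fun a => \sum_(k < F a) G a k).
Proof.
move=> cF cG.
apply: (@computable_ext _ _ _ _ (fun a => nat_rect _ 0 (fun k z => z + G a k) (F a))).
  move=> a; elim: (F a) => [|k /= ->]; first by rewrite big_ord0.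
  by rewrite big_ord_recr.
apply: (computable_natrec (G := fun a k z => z + G a k) cF (computable_const 0)).
apply: computable_add; first exact/computable_snd/computable_snd/computable_id.
apply: (computable_comp cG (F := fun q : T * (nat * nat) => (q.1, q.2.1))).
apply: computable_pair; first exact/computable_fst/computable_id.
exact/computable_fst/computable_snd/computable_id.
Qed.

End computable_bounded.

Section computable_cons.
Local Open Scope nat_scope.
Context (T A : Type) {eT : encodable T} {eA : encodable A}.

Lemma computable_cons (F : T -> A) (G : T -> seq A) :
  computable F -> computable G -> computable (fun a => F a :: G a).
Proof.
move=> [f fF] [g gG]; have [p pP] := total_recS total_rec_npair.
exists (rcomp p [:: f; g]) => a.
apply: (@reval_rcomp _ _ _ [:: enc (F a); enc (G a)]) => [//|[|[]]//|].
by rewrite enc_cons; exact: pP.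
Qed.

Lemma computable_enc (G : T -> A) : computable G -> computable (fun a => enc (G a)).
Proof. by []. Qed.

End computable_cons.

Section computable_uncons.
Local Open Scope nat_scope.
Context (T A : Type) {eT : encodable T} {eA : encodable A}.

Lemma computable_isnil (G : T -> seq A) :
  computable G -> computableb (fun a => nilp (G a)).
Proof.
move=> cG; apply: computable_ext (computable_eqn (computable_enc cG) (computable_const 0)) => a.
by case: (G a) => // x s; rewrite enc_cons.
Qed.

Lemma computable_head (x0 : A) (G : T -> seq A) :
  computable G -> computable (fun a => head x0 (G a)).
Proof.
move=> cG; apply: (@computable_ext _ _ _ _
  (fun a => if nilp (G a) then x0 else dec (nunpair (enc (G a)).-1).1)) => [a|].
  by case: (G a) => // x s; rewrite enc_cons succnK npairK; exact: encK.
apply: computable_if; [exact: computable_isnil|exact: computable_const|].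
have [f fF] := computable_nunpair1 (computable_pred (computable_enc cG)).
by exists f => a; rewrite decK; exact: fF.
Qed.

Lemma computable_behead (G : T -> seq A) :
  computable G -> computable (fun a => behead (G a)).
Proof.
move=> cG; apply: (@computable_ext _ _ _ _
  (fun a => if nilp (G a) then [::] else dec (nunpair (enc (G a)).-1).2)) => [a|].
  by case: (G a) => // x s; rewrite enc_cons succnK npairK; exact: encK.
apply: computable_if; [exact: computable_isnil|exact: computable_const|].
have [f fF] := computable_nunpair2 (computable_pred (computable_enc cG)).
by exists f => a; rewrite decK; exact: fF.
Qed.

End computable_uncons.

Ltac computability := repeat (cbv beta; match goal with
  | H : computable ?F |- computable ?F => exact H
  | H : computableb ?F |- computableb ?F => exact H
  | |- computable (fun _ => ?c) => exact: computable_const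
  | |- computable fst => exact (computable_fst (F := id) computable_id)
  | |- computable snd => exact (computable_snd (F := id) computable_id)
  | |- computable (fun a => a) => exact: computable_id
  | |- computable (fun a => (@?F a, @?G a)) => refine (computable_pair (F := F) (G := G) _ _)
  | |- computable (fun a => (@?F a).1) => refine (computable_fst (F := F) _)
  | |- computable (fun a => (@?F a).2) => refine (computable_snd (F := F) _)
  | |- computable (fun a => @?F a :: @?G a) => refine (computable_cons (F := F) (G := G) _ _)
  | |- computable (fun a => behead (@?F a)) => refine (computable_behead (G := F) _)
  | |- computable (fun a => head ?x (@?F a)) => refine (computable_head x (G := F) _)
  | |- computable (fun a => nat_of_bool (@?p a)) => change (computableb p)
  | |- computableb (fun a => @?F a && @?G a) => refine (computable_and (p := F) (q := G) _ _)
  | |- computableb (fun a => @?F a || @?G a) => refine (computable_or (p := F) (q := G) _ _)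
  | |- computableb (fun a => ~~ @?F a) => refine (computable_not (p := F) _)
  | |- computableb (fun a => (@?F a < @?G a)%N) => refine (computable_ltn (F := F) (G := G) _ _)
  | |- computableb (fun a => (@?F a <= @?G a)%N) => refine (computable_leq (F := F) (G := G) _ _)
  | |- computableb (fun a => @?F a == @?G a :> nat) => refine (computable_eqn (F := F) (G := G) _ _)
  | |- computableb (fun a => nilp (@?F a)) => refine (computable_isnil (G := F) _)
  | |- computable (fun a => (@?F a).+1) => refine (computable_succ (F := F) _)
  | |- computable (fun a => (@?F a).-1) => refine (computable_pred (F := F) _)
  | |- computable (fun a => (@?F a + @?G a)%N) => refine (computable_add (F := F) (G := G) _ _)
  | |- computable (fun a => (@?F a - @?G a)%N) => refine (computable_sub (F := F) (G := G) _ _)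
  | |- computable (fun a => (@?F a * @?G a)%N) => refine (computable_mul (F := F) (G := G) _ _)
  | |- computable (fun a => (@?F a ^ @?G a)%N) => refine (computable_exp (F := F) (G := G) _ _)
  end).

Section computable_fold.
Local Open Scope nat_scope.
Context (T A B : Type) {eT : encodable T} {eA : encodable A} {eB : encodable B}.

Lemma size_enc (s : seq A) : size s <= enc s.
Proof.
elim: s => // x s IH; rewrite enc_cons ltnS; apply: (leq_trans IH).
rewrite -ltnS npairS -[(enc s).+1]mul1n leq_mul ?expn_gt0//.
by rewrite ltnS -addnn leq_addr.
Qed.

(** Recursion runs over numbers only, so the fold iterates a step on pairs of an accumulator and a
    remaining list. The code of the list serves as fuel: it bounds the length by [size_enc], and
    surplus steps idle on the empty list. *)
Lemma computable_foldl (F : T -> B -> A -> B) (Z : T -> B) (G : T -> seq A) :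
  computable (fun p : T * (B * A) => F p.1 p.2.1 p.2.2) ->
  computable Z -> computable G ->
  computable (fun a => foldl (F a) (Z a) (G a)).
Proof.
move=> cF cZ cG; pose x0 := @dec A eA 0.
pose step a (_ : nat) (zs : B * seq A) := if nilp zs.2 then zs else
  (F a zs.1 (head x0 zs.2), behead zs.2).
have stepE a n s z : size s <= n ->
    nat_rect _ (z, s) (step a) n = (foldl (F a) z s, [::]).
  move=> sn.
  have -> : forall c, nat_rect _ c (step a) n = iter n (step a 0) c.
    by move=> c; elim: n {sn} => //= n ->.
  elim: s n z sn => [|x s IH] [|n] z //=.
    by move=> _; rewrite -iterS; elim: n => //= n ->.
  by move=> sn; rewrite -iterS iterSr; exact: IH.
apply: (@computable_ext _ _ _ _
    (fun a => (nat_rect (fun=> B * seq A)%type (Z a, G a) (step a) (enc (G a))).1)).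
  by move=> a; rewrite stepE// size_enc.
apply: computable_fst; apply: computable_natrec.
- exact: computable_enc.
- exact: computable_pair.
apply: computable_if; computability.
apply: (computable_comp cF (F := fun p : T * (nat * (B * seq A)) =>
  (p.1, (p.2.2.1, head x0 p.2.2.2)))).
computability.
Qed.

End computable_fold.

Section computable_seq_ops.
Local Open Scope nat_scope.
Context (T A B : Type) {eT : encodable T} {eA : encodable A} {eB : encodable B}.

Lemma computable_rev (G : T -> seq A) : computable G -> computable (fun a => rev (G a)).
Proof.
move=> cG; apply: (@computable_ext _ _ _ _
    (fun a => foldl (fun s x => x :: s) [::] (G a))).
  by move=> a; rewrite /rev; elim: (G a) [::] => //= x s IH t; rewrite IH.
by apply: (computable_foldl (F := fun _ s x => x :: s)); computability.
Qed.

Lemma computable_map (F : T -> A -> B) (G : T -> seq A) :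
  computable (fun p : T * A => F p.1 p.2) -> computable G ->
  computable (fun a => map (F a) (G a)).
Proof.
move=> cF cG; apply: (@computable_ext _ _ _ _
    (fun a => foldl (fun s x => F a x :: s) [::] (rev (G a)))).
  by move=> a; rewrite foldl_rev; elim: (G a) => //= x s ->.
apply: (computable_foldl (F := fun a s x => F a x :: s)); first last.
- exact: computable_rev.
- computability.
apply: computable_cons; last computability.
apply: (computable_comp cF (F := fun p : T * (seq B * A) => (p.1, p.2.2))).
computability.
Qed.

Lemma computable_all (p : T -> A -> bool) (G : T -> seq A) :
  computableb (fun q : T * A => p q.1 q.2) -> computable G ->
  computableb (fun a => all (p a) (G a)).
Proof.
move=> cp cG; apply: (@computable_ext _ _ _ _
    (fun a => foldl (fun b x => nat_of_bool ((b != 0) && p a x)) 1 (G a))).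
  move=> a; set f := fun b x => _.
  suff fE b : foldl f (nat_of_bool b) (G a) = b && all (p a) (G a) by exact: (fE true).
  elim: (G a) b => [|x s IH] b /=; first by rewrite andbT.
  by rewrite andbA -IH /f; case: b.
apply: (computable_foldl (F := fun a b x => nat_of_bool ((b != 0) && p a x))).
- apply: (computable_and (T := T * (nat * A))); first computability.
  apply: (computable_comp cp (F := fun p : T * (nat * A) => (p.1, p.2.2))).
  computability.
- computability.
- computability.
Qed.

Lemma computable_sum_seq (F : T -> A -> nat) (G : T -> seq A) :
  computable (fun q : T * A => F q.1 q.2) -> computable G ->
  computable (fun a => \sum_(x <- G a) F a x).
Proof.
move=> cF cG; apply: (@computable_ext _ _ _ _
    (fun a => foldl (fun b x => b + F a x) 0 (G a))).
  move=> a; set f := fun b x => _.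
  suff fE b : foldl f b (G a) = b + \sum_(x <- G a) F a x by rewrite fE.
  elim: (G a) b => [|x s IH] b /=; first by rewrite big_nil addn0.
  by rewrite big_cons IH /f addnA.
apply: (computable_foldl (F := fun a b x => b + F a x)).
- apply: (computable_add (T := T * (nat * A))); first computability.
  apply: (computable_comp cF (F := fun p : T * (nat * A) => (p.1, p.2.2))).
  computability.
- computability.
- computability.
Qed.

End computable_seq_ops.

Lemma enc_seq_nat (s : seq nat) : enc s = CodeSeq.code s.
Proof. exact: (congr1 CodeSeq.code (map_id s)). Qed.

Section computable_nth.
Local Open Scope nat_scope.
Context (T A : Type) {eT : encodable T} {eA : encodable A}.

Lemma computable_nth (x0 : A) (G : T -> seq A) i :
  computable G -> computable (fun a => nth x0 (G a) i).
Proof.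
elim: i G => [|i IH] G cG.
  by apply: computable_ext (computable_head x0 cG) => a; rewrite nth0.
by apply: computable_ext (IH _ (computable_behead cG)) => a; rewrite nth_behead.
Qed.

Lemma computable_decode (F : T -> nat) :
  computable F -> computable (fun a => CodeSeq.decode (F a)).
Proof.
move=> [f fF]; exists f => a.
by rewrite enc_seq_nat CodeSeq.decodeK; exact: fF.
Qed.

Lemma computable_code (F : T -> seq nat) :
  computable F -> computable (fun a => CodeSeq.code (F a)).
Proof.
move=> [f fF]; exists f => a; have := fF a.
by rewrite (enc_seq_nat (F a)).
Qed.

End computable_nth.

Lemma computable_entry (T : Type) {eT : encodable T} (F : T -> nat) i :
  computable F -> computable (fun a => entry (F a) i).
Proof. by move=> cF; exact/computable_nth/computable_decode. Qed.

(** * Step-bounded evaluation *)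

Section run.
Local Open Scope nat_scope.

(** One step of a minimisation whose state is 0 while searching, [y.+2] once y is found, and 1 after
    meeting a value that is unknown within the budget: from then on no minimum can be certified. The
    predecessor taken in [run] merges the two failures into 0. *)
Definition min_step (F : nat -> nat) (j st : nat) : nat :=
  if st != 0 then st else if F j == 1 then j.+2 else if F j == 0 then 1 else 0.

(* [run f k v] is [y.+1] if f halts on v with value y within a budget k, and 0
   otherwise; the budget only bounds the range of the unbounded searches. *)
Fixpoint run (f : recfun) (k : nat) (v : seq nat) : nat :=
  match f with
  | RZero => 1
  | RSucc => (nth 0 v 0).+2
  | RProj i => (nth 0 v i).+1
  | RComp m g h =>
      let ws := [seq run (h i) k v | i <- enum 'I_m] in
      if all (fun w => w != 0) ws then run g k (map predn ws) else 0
  | RPrec g h => nat_rect (fun=> nat) (run g k (behead v))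
      (fun j z => if z == 0 then 0 else run h k [:: j, z.-1 & behead v])
      (nth 0 v 0)
  | RMin g => (nat_rect (fun=> nat) 0 (min_step (fun j => run g k (j :: v))) k).-1
  end.

Lemma min_search_found (F : nat -> nat) k y :
  nat_rect (fun=> nat) 0 (min_step F) k = y.+2 ->
  F y = 1 /\ forall z, z < y -> exists u, F z = u.+2.
Proof.
have scan j : nat_rect (fun=> nat) 0 (min_step F) j = 0 ->
    forall z, z < j -> exists u, F z = u.+2.
  elim: j => //= j IH; rewrite {1}/min_step.
  case: eqP => //= E; case: eqP => // F1; case: eqP => // F0 _ z.
  rewrite ltnS leq_eqVlt => /orP[/eqP->|]; last exact: IH.
  by case: (F j) F0 F1 => [|[|u]] // _ _; exists u.
elim: k => //= k IH; rewrite {1}/min_step.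
case: eqP => //= E; case: eqP => // [F1 [<-]|_]; last by case: eqP.
by split => //; exact: scan.
Qed.

Lemma min_search_complete (F : nat -> nat) k y : y < k -> F y = 1 ->
  (forall z, z < y -> exists u, F z = u.+2) ->
  nat_rect (fun=> nat) 0 (min_step F) k = y.+2.
Proof.
move=> yk Fy Fz.
have scan j : j <= y -> nat_rect (fun=> nat) 0 (min_step F) j = 0.
  elim: j => //= j IH jy; rewrite IH; last exact: ltnW.
  by have [u Fj] := Fz _ jy; rewrite /min_step /= Fj.
rewrite -(subnKC yk); elim: (k - y.+1) => [|i IH].
  by rewrite addn0 /= scan// /min_step /= Fy.
by rewrite addnS; move: (y.+1 + i) IH => n /= ->.
Qed.

Lemma run_sound f k v y : run f k v = y.+1 -> reval f v y.
Proof.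
elim: f k v y => [||i|m g IHg h IHh|g IHg h IHh|g IHg] k v y /=.
- by case.
- by case.
- by case.
- case: ifP => //= /allP ws gy.
  exists [tuple (run (h i) k v).-1 | i < m].
    move=> i; rewrite tnth_mktuple; apply: (IHh i k).
    by rewrite prednK// lt0n; apply: ws; apply/mapP; exists i; rewrite ?mem_enum.
  by apply: (IHg k); rewrite -gy -map_comp.
- elim: (nth 0 v 0) y => [|j IH] y /=; first exact: IHg.
  case: eqP => // z0 hy; eexists; last exact: IHh hy.
  by apply: IH; rewrite prednK// lt0n; apply/eqP.
- case E: (nat_rect _ _ _ _) => [|[|z]] //= [<-].
  have [gy gz] := min_search_found E; split; first exact: (IHg k).
  by move=> j /gz[u ju]; exists u; exact: (IHg k).
Qed.

(** The value persists for all larger budgets, so that the budgets of subcomputations can be merged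
    by taking maxima. *)
Lemma run_complete f v y : reval f v y ->
  exists k0, forall k, k0 <= k -> run f k v = y.+1.
Proof.
elim: f v y => [||i|m g IHg h IHh|g IHg h IHh|g IHg].
- by move=> v y /= ->; exists 0.
- by move=> v y /= ->; exists 0.
- by move=> v y /= ->; exists 0.
- move=> v y /= [w hw gy].
  have [k0 k0P] := IHg _ _ gy.
  have /choice[K KP] : forall i, exists k0, forall k, k0 <= k ->
    run (h i) k v = (tnth w i).+1 by move=> i; exact: IHh.
  exists (maxn k0 (\max_i K i)) => k; rewrite geq_max => /andP[k0k Kk].
  have -> : [seq run (h i) k v | i <- enum 'I_m] = map succn w.
    rewrite -[tval w]map_tnth_enum -map_comp.
    apply/eq_map => i /=; apply: KP; apply: leq_trans Kk.
    exact: (leq_bigmax i).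
  rewrite all_map; case: ifP => [_|/negP[]]; last by apply/allP.
  by rewrite -map_comp map_id; exact: k0P.
- move=> v y /=; elim: (nth 0 v 0) y => [|j IH] y /=; first exact: IHg.
  move=> [z /IH[k1 k1P] /IHh[k2 k2P]].
  exists (maxn k1 k2) => k; rewrite geq_max => /andP[k1k k2k].
  by rewrite k1P//= k2P.
- move=> v y /= [/IHg[k0 k0P] gz].
  have /choice[K KP] : forall z, exists k0, z < y -> forall k, k0 <= k ->
      exists u, run g k (z :: v) = u.+2.
    move=> z; have [zy|_] := ltnP z y; last by exists 0.
    have [u /IHg[k1 k1P]] := gz _ zy.
    by exists k1 => _ k k1k; exists u; exact: k1P.
  exists (maxn y.+1 (maxn k0 (\max_(z < y) K z))) => k.
  rewrite !geq_max => /and3P[yk k0k Kk].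
  rewrite (min_search_complete yk)//; first exact: k0P.
  move=> z zy; apply: KP => //; apply: leq_trans Kk.
  exact: (leq_bigmax (Ordinal zy)).
Qed.

(** The scheme f is fixed: the induction builds one evaluator per f, not a universal function. *)
Lemma computable_run f : computable (fun p : nat * seq nat => run f p.1 p.2).
Proof.
have csnd : computable (fun p : nat * seq nat => p.2) by computability.
elim: f => [||i|m g IHg h IHh|g IHg h IHh|g IHg].
- exact: computable_const.
- exact: (computable_succ (computable_succ (computable_nth 0 0 csnd))).
- exact: (computable_succ (computable_nth 0 i csnd)).
- have cws : computable (fun p : nat * seq nat => [seq run (h i) p.1 p.2 | i <- enum 'I_m]).
    elim: (enum 'I_m) => [|i s IH] /=; first exact: computable_const.
    exact: computable_cons.
  apply: computable_if; last exact: computable_const.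
    apply: (computable_all (p := fun _ w => w != 0)) => //.
    by computability.
  apply: (computable_comp IHg (F := fun p : nat * seq nat =>
    (p.1, map predn [seq run (h i) p.1 p.2 | i <- enum 'I_m]))).
  apply: computable_pair; [by computability|].
  have cp : computable (fun q : (nat * seq nat) * nat => q.2.-1) by computability.
  exact: (computable_map (F := fun _ => predn) cp cws).
- apply: (computable_natrec
    (G := fun p j z => if z == 0 then 0 else run h p.1 [:: j, z.-1 & behead p.2])).
  + exact: (computable_nth 0 0 csnd).
  + apply: (computable_comp IHg (F := fun p : nat * seq nat => (p.1, behead p.2))).
    computability.
  + apply: computable_if; first by computability.
      computability.
    apply: (computable_comp IHh (F := fun p : nat * seq nat * (nat * nat) =>
      (p.1.1, [:: p.2.1, p.2.2.-1 & behead p.1.2]))).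
    computability.
- apply: computable_pred; apply: (computable_natrec
    (G := fun p => min_step (fun j => run g p.1 (j :: p.2)))); [computability..|].
  have cg : computable (fun p : nat * seq nat * (nat * nat) =>
      run g p.1.1 (p.2.1 :: p.1.2)).
    apply: (computable_comp IHg (F := fun p : nat * seq nat * (nat * nat) =>
      (p.1.1, p.2.1 :: p.1.2))).
    computability.
  apply: computable_if; first by computability.
    computability.
  apply: computable_if; [by computability|computability|].
  apply: computable_if; [by computability|computability..].
Qed.

End run.

(** * Semidecidable predicates *)

Section semidecidable.
Local Open Scope nat_scope.

Definition semidec {T} {eT : encodable T} (A : T -> Prop) : Prop :=
  exists2 p : T -> nat -> bool, computableb (fun q : T * nat => p q.1 q.2) &
    forall t, A t <-> exists k, p t k.

Lemma enumerable_semidec (A : set (seq nat)) : enumerable A -> semidec A.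
Proof.
move=> [f fA].
(* The witness n pairs a budget with the argument at which f outputs the code of s. *)
exists (fun s n => run f (nunpair n).1 [:: (nunpair n).2] == (CodeSeq.code s).+1).
  apply: (computable_eqn (T := seq nat * nat)).
    apply: (computable_comp (computable_run f) (F := fun q : seq nat * nat =>
      ((nunpair q.2).1, [:: (nunpair q.2).2]))).
    have c1 : computable (fun q : seq nat * nat => (nunpair q.2).1).
      by apply: computable_nunpair1; computability.
    have c2 : computable (fun q : seq nat * nat => (nunpair q.2).2).
      by apply: computable_nunpair2; computability.
    by apply: computable_pair => //; apply: computable_cons => //; computability.
  by apply: computable_succ; apply: computable_code; computability.
move=> s; rewrite fA; split=> [[k /run_complete[k0 k0P]]|[n /eqP/run_sound]].
  by exists (npair k0 k); rewrite npairK /= k0P.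
by eexists; eassumption.
Qed.

(** On the code of a pair (s, k) the enumerator minimises over z the negation of [p s k] and z =
    code s: it outputs the code of s when k witnesses s, and diverges otherwise. *)
Lemma semidec_enumerable (A : set (seq nat)) : semidec A -> enumerable A.
Proof.
move=> [p cp pA].
have [f fF] : computable (fun q : nat * (seq nat * nat) =>
    nat_of_bool (~~ (p q.2.1 q.2.2 && (q.1 == CodeSeq.code q.2.1)))).
  apply: (computable_not (T := nat * (seq nat * nat))).
  apply: computable_and; first by apply: (computable_comp cp); computability.
  apply: computable_eqn; first by computability.
  by apply: computable_code; computability.
have [g gP] := total_rec_npair.
have gE z (c : seq nat * nat) : reval (rcomp g [:: RProj 0; RProj 1]) [:: z; enc c] (enc (z, c)).
  by apply: (@reval_rcomp _ _ _ [:: z; enc c]) => // -[|[]].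
exists (RMin (rcomp f [:: rcomp g [:: RProj 0; RProj 1]])) => s.
have fE z (c : seq nat * nat) y :
    reval (rcomp f [:: rcomp g [:: RProj 0; RProj 1]]) [:: z; enc c] y <->
    y = ~~ (p c.1 c.2 && (z == CodeSeq.code c.1)).
  have H : reval (rcomp f [:: rcomp g [:: RProj 0; RProj 1]]) [:: z; enc c]
      (~~ (p c.1 c.2 && (z == CodeSeq.code c.1))).
    apply: (@reval_rcomp _ _ _ [:: enc (z, c)]) => //.
      by move=> [|//] _; exact: gE.
  (* Determinism of [reval], obtained by running both computations with a common budget. *)
  split=> [/run_complete[k1 k1P]|->//].
  have [k2 k2P] := run_complete H.
  have := k1P (maxn k1 k2); rewrite leq_maxl => /(_ isT).
  by rewrite k2P ?leq_maxr// => -[].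
rewrite pA; split=> [[k psk]|[n [/=]]].
  exists (enc (s, k)); split; first by apply/(fE _ (s, k)); rewrite /= psk eqxx.
  move=> z zs; exists 0; apply/(fE _ (s, k)) => /=.
  by rewrite psk (ltn_eqF zs).
rewrite -[n](decK (T := seq nat * nat)); move: (dec n : seq nat * nat) => c.
move=> /(fE _ c) E _; exists c.2; move: E.
case E : (p _ _) => //=; case: eqP => // /(can_inj CodeSeq.codeK) ->.
by rewrite E.
Qed.

End semidecidable.

Section semidec_closure.
Local Open Scope nat_scope.
Context (T U : Type) {eT : encodable T} {eU : encodable U}.
Implicit Types A B : T -> Prop.

Lemma semidec_ext A B : (forall t, A t <-> B t) -> semidec A -> semidec B.
Proof. by move=> AB [p cp pA]; exists p => // t; rewrite -AB. Qed.

Lemma semidec_computable (p : T -> bool) : computableb p -> semidec (fun t => p t).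
Proof.
move=> cp; exists (fun t _ => p t); last by move=> t; split=> [?|[]//]; exists 0.
by apply: (computable_comp cp); computability.
Qed.

Lemma semidec_comp (A : U -> Prop) (F : T -> U) :
  semidec A -> computable F -> semidec (fun t => A (F t)).
Proof.
move=> [p cp pA] cF; exists (fun t k => p (F t) k); last by move=> t; exact: pA.
apply: (computable_comp cp (F := fun q : T * nat => (F q.1, q.2))).
by apply: computable_pair; [apply: (computable_comp cF)|]; computability.
Qed.

Lemma semidec_or A B : semidec A -> semidec B -> semidec (fun t => A t \/ B t).
Proof.
move=> [p cp pA] [q cq qB]; exists (fun t k => p t k || q t k).
  exact: (computable_or cp cq).
move=> t; rewrite pA qB; split=> [[] [k kP]|[k /orP[]kP]].
- by exists k; rewrite kP.
- by exists k; rewrite kP orbT.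
- by left; exists k.
- by right; exists k.
Qed.

Lemma semidec_ex (A : T -> U -> Prop) :
  semidec (fun q : T * U => A q.1 q.2) -> semidec (fun t => exists u, A t u).
Proof.
move=> [p cp pA]; exists (fun t n => p (t, dec (nunpair n).1) (nunpair n).2).
  have c1 : computable (fun q : T * nat => dec (nunpair q.2).1 : U).
    have [f fF] : computable (fun q : T * nat => (nunpair q.2).1).
      by apply: computable_nunpair1; computability.
    by exists f => a; rewrite decK.
  have c2 : computable (fun q : T * nat => (nunpair q.2).2).
    by apply: computable_nunpair2; computability.
  apply: (computable_comp cp (F := fun q : T * nat =>
    ((q.1, dec (nunpair q.2).1), (nunpair q.2).2))).
  by computability.
move=> t; split=> [[u /(pA (t, u))[k pk]]|[n pn]].
  by exists (npair (enc u) k); rewrite npairK /= encK.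
by exists (dec (nunpair n).1); apply/(pA (t, dec (nunpair n).1)); eexists; exact: pn.
Qed.

End semidec_closure.

Section semidec_and_all.
Local Open Scope nat_scope.
Context (T : Type) {eT : encodable T} (U : eqType) {eU : encodable U}.
Implicit Types A B : T -> Prop.

Lemma semidec_and A B : semidec A -> semidec B -> semidec (fun t => A t /\ B t).
Proof.
move=> [p cp pA] [q cq qB].
apply: (@semidec_ext _ _ (fun t => exists u : nat * nat, p t u.1 && q t u.2)).
  move=> t; rewrite pA qB; split=> [[[i j] /= /andP[pi qj]]|[[i pi] [j qj]]].
    by split; eexists; eassumption.
  by exists (i, j); rewrite pi qj.
apply: (semidec_ex (A := fun t u => p t u.1 && q t u.2)).
apply: semidec_computable; apply: (computable_and (T := T * (nat * nat))).
  by apply: (computable_comp cp (F := fun v : T * (nat * nat) => (v.1, v.2.1))); computability.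
by apply: (computable_comp cq (F := fun v : T * (nat * nat) => (v.1, v.2.2))); computability.
Qed.

(** Searching for a witness below n is monotone in n, so one bound serves all members of a finite
    list. *)
Lemma semidec_all (A : T -> U -> Prop) (L : T -> seq U) :
  semidec (fun q : T * U => A q.1 q.2) -> computable L ->
  semidec (fun t => forall u, u \in L t -> A t u).
Proof.
move=> [p cp pA] cL.
exists (fun t n => all (fun u => has (p (t, u)) (iota 0 n)) (L t)).
  apply: (computable_all (p := fun (q : T * nat) u => has (p (q.1, u)) (iota 0 q.2))
    (G := fun q : T * nat => L q.1)).
    apply: (computable_has_iota (p := fun q : T * nat * U => p (q.1.1, q.2))
      (F := fun q : T * nat * U => q.1.2)).
      by computability.
    apply: (computable_comp cp (F := fun q : T * nat * U * nat => ((q.1.1.1, q.1.2), q.2))).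
    by computability.
  by apply: (computable_comp cL); computability.
move=> t; split=> [LA|[n /allP Ln] u uL]; last first.
  by have /hasP[k _ pk] := Ln _ uL; apply/(pA (t, u)); exists k.
have /choice[K KP] : forall u, exists k, u \in L t -> p (t, u) k.
  move=> u; case: (boolP (u \in L t)) => [/LA/(pA (t, u))[k pk]|_]; last by exists 0.
  by exists k.
exists (\max_(u <- L t) (K u).+1); apply/allP => u uL; apply/hasP.
exists (K u); last exact: KP.
by rewrite mem_iota /= add0n; exact: (@leq_bigmax_seq _ _ xpredT (fun u => (K u).+1)).
Qed.

End semidec_and_all.

(** * Computable rational-valued functions *)

Section computable_rat.

Definition ratn (q : nat * nat * nat) : rat := (q.1.1%:R - q.1.2%:R) / q.2.+1%:R.

Lemma ratnE a b c : ratn (a, b, c) = (a%:R - b%:R) / c.+1%:R.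
Proof. by []. Qed.

(** Computability through some fraction, possibly not reduced: only the values and their order
    matter, so representatives never have to be normalised. *)
Definition computableq {T} {eT : encodable T} (F : T -> rat) : Prop :=
  exists2 G : T -> nat * nat * nat, computable G & forall t, F t = ratn (G t).

Context (T : Type) {eT : encodable T}.
Implicit Types F G : T -> rat.

Lemma computableq_div (F G H : T -> nat) : computable F -> computable G -> computable H ->
  computableq (fun t => ((F t)%:R - (G t)%:R) / (H t).+1%:R).
Proof. by move=> cF cG cH; exists (fun t => (F t, G t, H t)) => //; computability. Qed.

Lemma computableq_rat_of (F : T -> nat) :
  computable F -> computableq (fun t => rat_of (F t)).
Proof. by move=> cF; apply: computableq_div; exact: computable_entry. Qed.

Lemma computableq_nat (F : T -> nat) :
  computable F -> computableq (fun t => (F t)%:R).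
Proof.
move=> cF; exists (fun t => (F t, 0%N, 0%N)); first by computability.
by move=> t; rewrite /ratn /= subr0 divr1.
Qed.

Lemma computableq_posrat_of (F : T -> nat) :
  computable F -> computableq (fun t => posrat_of (F t)).
Proof.
move=> cF; exists (fun t => ((entry (F t) 0).+1, 0%N, entry (F t) 1)).
  apply: computable_pair; last exact: computable_entry.
  by apply: computable_pair; [exact/computable_succ/computable_entry|computability].
by move=> t; rewrite /ratn /= subr0.
Qed.

Lemma computableq_exp2N (F : T -> nat) :
  computable F -> computableq (fun t => 2 ^- (F t)).
Proof.
move=> cF; exists (fun t => (1%N, 0%N, (2 ^ F t).-1)); first by computability.
by move=> t; rewrite ratnE subr0 mul1r prednK ?expn_gt0// natrX.
Qed.

Lemma computableq_add F G : computableq F -> computableq G ->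
  computableq (fun t => F t + G t).
Proof.
move=> [f cf fF] [g cg gG]; exists (fun t => (
    ((f t).1.1 * (g t).2.+1 + (g t).1.1 * (f t).2.+1)%N,
    ((f t).1.2 * (g t).2.+1 + (g t).1.2 * (f t).2.+1)%N,
    ((f t).2.+1 * (g t).2.+1).-1)); first by computability.
move=> t; rewrite ratnE prednK ?muln_gt0// fF gG /ratn !natrD !natrM.
have nz n : n.+1%:R != 0 :> rat by rewrite pnatr_eq0.
move: (nz (f t).2) (nz (g t).2) => {nz}.
move: (f t).2.+1%:R (g t).2.+1%:R (f t).1.1%:R (f t).1.2%:R (g t).1.1%:R (g t).1.2%:R.
by move=> x y a b c d x0 y0; field; rewrite x0 y0.
Qed.

Lemma computableq_opp F : computableq F -> computableq (fun t => - F t).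
Proof.
move=> [f cf fF]; exists (fun t => ((f t).1.2, (f t).1.1, (f t).2)).
  by computability.
by move=> t; rewrite fF /ratn /= -mulNr opprB.
Qed.

Lemma computableq_mul F G : computableq F -> computableq G ->
  computableq (fun t => F t * G t).
Proof.
move=> [f cf fF] [g cg gG]; exists (fun t => (
    ((f t).1.1 * (g t).1.1 + (f t).1.2 * (g t).1.2)%N,
    ((f t).1.1 * (g t).1.2 + (f t).1.2 * (g t).1.1)%N,
    ((f t).2.+1 * (g t).2.+1).-1)); first by computability.
move=> t; rewrite ratnE prednK ?muln_gt0// fF gG /ratn !natrD !natrM.
have nz n : n.+1%:R != 0 :> rat by rewrite pnatr_eq0.
move: (nz (f t).2) (nz (g t).2) => {nz}.
move: (f t).2.+1%:R (g t).2.+1%:R (f t).1.1%:R (f t).1.2%:R (g t).1.1%:R (g t).1.2%:R.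
by move=> x y a b c d x0 y0; field; rewrite x0 y0.
Qed.

Lemma computableq_le F G : computableq F -> computableq G ->
  computableb (fun t => F t <= G t).
Proof.
move=> [f cf fF] [g cg gG]; apply: (@computable_ext _ _ _ _ (fun t => nat_of_bool (
    (f t).1.1 * (g t).2.+1 + (g t).1.2 * (f t).2.+1 <=
    (g t).1.1 * (f t).2.+1 + (f t).1.2 * (g t).2.+1)%N)); last by computability.
move=> t; rewrite fF gG /ratn ler_pdivrMr ?ltr0n// mulrAC ler_pdivlMr ?ltr0n//.
rewrite -(ler_nat rat) !natrD !natrM; congr nat_of_bool.
by apply/idP/idP => ?; lra.
Qed.

Lemma computableq_lt F G : computableq F -> computableq G ->
  computableb (fun t => F t < G t).
Proof.
move=> cF cG; apply: computable_ext (computable_not (computableq_le cG cF)) => t.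
by rewrite -ltNge.
Qed.

Lemma computableq_comp (U : Type) (eU : encodable U) (F : U -> rat) (G : T -> U) :
  computableq F -> computable G -> computableq (fun t => F (G t)).
Proof.
by move=> [f cf fF] cG; exists (fun t => f (G t)) => //; exact: computable_comp cf cG.
Qed.

End computable_rat.

(** * Codes of rationals and of balls *)

Section codes.
Context (R : realType).

Lemma entry_code (s : seq nat) i : entry (CodeSeq.code s) i = nth 0%N s i.
Proof. by rewrite /entry CodeSeq.codeK. Qed.

Lemma posrat_of_gt0 n : 0 < posrat_of n.
Proof. by rewrite /posrat_of divr_gt0 ?ltr0n. Qed.

Lemma posrat_of_small (e : R) : 0 < e -> exists n, ratr (posrat_of n) < e.
Proof.
move=> e0; exists (CodeSeq.code [:: 0%N; Num.truncn e^-1]).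
have -> : posrat_of (CodeSeq.code [:: 0%N; Num.truncn e^-1]) = (Num.truncn e^-1).+1%:R^-1.
  by rewrite /posrat_of !entry_code mul1r.
rewrite fmorphV rmorph_nat.
by rewrite invf_plt ?posrE ?ltr0n// truncnS_gt// realE invr_ge0 ltW.
Qed.

Lemma rat_of_surj (q : rat) : exists n, rat_of n = q.
Proof.
have [n dn] : exists n, denq q = n.+1%:Z.
  by exists `|denq q|.-1%N; rewrite prednK ?absz_gt0 ?denq_neq0// gez0_abs// ltW// denq_gt0.
have -> : q = (numq q)%:Q / n.+1%:R by rewrite -{1}(divq_num_den q) dn.
case: (numq q) => m.
  by exists (CodeSeq.code [:: m; 0%N; n]); rewrite /rat_of !entry_code /= subr0.
exists (CodeSeq.code [:: 0%N; m.+1; n]); rewrite /rat_of !entry_code /=.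
by rewrite sub0r NegzE mulrNz.
Qed.

Lemma rat_of_between (x y : R) : x < y -> exists n, x < ratr (rat_of n) < y.
Proof.
move=> /rat_in_itvoo[q]; rewrite in_itv /= => xqy.
by have [n nq] := rat_of_surj q; exists n; rewrite nq.
Qed.

Lemma rat_of_between_ereal (x : R) (y : \bar R) : (x%:E < y)%E ->
  exists n, x < ratr (rat_of n) /\ ((ratr (rat_of n))%:E < y)%E.
Proof.
case: y => [y| |//].
  by rewrite lte_fin => /rat_of_between[n /andP[]]; exists n.
have x1 : x < x + 1 by rewrite ltrDl.
by move=> _; have [n /andP[xn _]] := rat_of_between x1; exists n; rewrite ltry.
Qed.

End codes.

(** * Ideal points and formal inclusion of balls *)

Section ideal_points.
Context (R : realType) (X : constructiveMetricType R).
Local Notation a := (@ideal_point R X).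

Definition center_index (n : nat) : nat := entry n 0.
Definition ball_radius (n : nat) : rat := posrat_of (entry n 1).

Lemma basic_ballP n (x : X) :
  basic_ball a n x <-> mdist (a (center_index n)) x < ratr (ball_radius n).
Proof. by rewrite /basic_ball ballEmdist. Qed.

Lemma computable_center_index T {eT : encodable T} (F : T -> nat) :
  computable F -> computable (fun t => center_index (F t)).
Proof. exact: computable_entry. Qed.

Lemma computableq_ball_radius T {eT : encodable T} (F : T -> nat) :
  computable F -> computableq (fun t => ball_radius (F t)).
Proof. by move=> cF; exact/computableq_posrat_of/computable_entry. Qed.

Lemma mdist_approx : exists2 D : nat * nat * nat -> rat, computableq D &
  forall i j k, `|mdist (a i) (a j) - ratr (D (i, j, k))| <= 2 ^- k.
Proof.
have [f fP] := @ideal_point_mdist R X.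
have /choice[N NP] : forall p : nat * nat * nat, exists n,
    reval f [:: p.1.1; p.1.2; p.2] n /\
    `|mdist (a p.1.1) (a p.1.2) - ratr (rat_of n)| <= 2 ^- p.2.
  by move=> p; have [n] := fP p.1.1 p.1.2 p.2; exists n.
exists (fun p => rat_of (N p)); last by move=> i j k; have [] := NP (i, j, k).
apply: computableq_rat_of.
have [h1 h1P] : computable (fun p : nat * nat * nat => p.1.1) by computability.
have [h2 h2P] : computable (fun p : nat * nat * nat => p.1.2) by computability.
have [h3 h3P] : computable (fun p : nat * nat * nat => p.2) by computability.
exists (rcomp f [:: h1; h2; h3]) => p.
apply: (@reval_rcomp _ _ _ [:: p.1.1; p.1.2; p.2]) => //.
  by move=> [|[|[]]].
by have [] := NP p.
Qed.

Lemma exp2N_small (e : R) : 0 < e -> exists k, 2 ^- k < e.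
Proof.
move=> e0; exists (Num.truncn e^-1).+1.
rewrite invf_plt ?posrE ?exprn_gt0//.
have := truncnS_gt e^-1; set n := (_.+1)%N => en.
by apply: (lt_le_trans en); rewrite -natrX ler_nat ltnW// ltn_expl.
Qed.

Lemma semidec_mdist_lt T {eT : encodable T} (F G : T -> nat) (Q : T -> rat) :
  computable F -> computable G -> computableq Q ->
  semidec (fun t => mdist (a (F t)) (a (G t)) < ratr (Q t)).
Proof.
move=> cF cG cQ; have [D cD DP] := mdist_approx.
apply: (@semidec_ext _ _ (fun t => exists k, D (F t, G t, k) + 2 ^- k < Q t)).
  move=> t; split=> [[k kP]|dQ].
    have /(_ (F t) (G t) k) := DP; rewrite ler_norml => /andP[_ dD].
    have : ratr (D (F t, G t, k) + 2 ^- k) < ratr (Q t) :> R by rewrite ltr_rat.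
    rewrite rmorphD /= fmorphV rmorphXn /= ratr_nat; lra.
  (* Half of the gap, because the approximation error and the added margin each cost 2^-k. *)
  have [k kP] : exists k, 2 ^- k < (ratr (Q t) - mdist (a (F t)) (a (G t))) / 2.
    by apply: exp2N_small; rewrite divr_gt0 ?subr_gt0.
  exists k; rewrite -(ltr_rat R) rmorphD /= fmorphV rmorphXn /= ratr_nat.
  have /(_ (F t) (G t) k) := DP; rewrite ler_norml => /andP[dD _]; lra.
apply: (semidec_ex (A := fun t k => D (F t, G t, k) + 2 ^- k < Q t)).
apply: semidec_computable; apply: computableq_lt.
  apply: computableq_add; last by apply: computableq_exp2N; computability.
  apply: (computableq_comp (G := fun p : T * nat => (F p.1, G p.1, p.2))) => //.
  by apply: computable_pair; [apply: computable_pair|computability];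
    [apply: (computable_comp cF)|apply: (computable_comp cG)]; computability.
by apply: (computableq_comp cQ); computability.
Qed.

(* Formal inclusion of the ball coded by n in the ball of centre [a c], radius q. *)
Definition finer (n c : nat) (q : rat) : Prop :=
  mdist (a (center_index n)) (a c) < ratr (q - ball_radius n).

Lemma finer_sub n c q (x : X) :
  finer n c q -> basic_ball a n x -> mdist (a c) x < ratr q.
Proof.
rewrite /finer => nc /basic_ballP nx.
apply: (le_lt_trans (metric_triangle _ (a (center_index n)) _)).
by move: nc; rewrite rmorphB /= metric_sym; lra.
Qed.

Lemma ball_refine (x : X) (L : seq (nat * rat)) :
  (forall p, p \in L -> mdist (a p.1) x < ratr p.2) ->
  exists2 n, basic_ball a n x & forall p, p \in L -> finer n p.1 p.2.
Proof.
move=> Lx.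
(* Slack is reserved twice: for the distance from x to the new centre, and for the new radius. *)
have [e e0 eL] : exists2 e : R, 0 < e & forall p, p \in L ->
    mdist (a p.1) x + e + e < ratr p.2.
  elim: L Lx => [_|p L IH Lx]; first by exists 1.
  have [|e e0 eL] := IH; first by move=> q qL; apply: Lx; rewrite inE qL orbT.
  have px := Lx p (mem_head _ _).
  exists (Num.min e ((ratr p.2 - mdist (a p.1) x) / 3)).
    by rewrite lt_min e0 divr_gt0// subr_gt0.
  move=> q; rewrite inE => /orP[/eqP->|/eL qe].
    have : Num.min e ((ratr p.2 - mdist (a p.1) x) / 3) <= (ratr p.2 - mdist (a p.1) x) / 3.
      by rewrite ge_min lexx orbT.
    lra.
  have : Num.min e ((ratr p.2 - mdist (a p.1) x) / 3) <= e by rewrite ge_min lexx.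
  lra.
have [r re] := posrat_of_small e0.
have r0 : 0 < ratr (posrat_of r) :> R by rewrite ltr0q posrat_of_gt0.
have [||y [yx [i _ iy]]] := @ideal_point_dense R X (ball x (ratr (posrat_of r))).
- by exists x; exact: ballxx.
- have -> : ball x (ratr (posrat_of r)) = fattening [set x] (ratr (posrat_of r)).
    apply/seteqP; split=> z; rewrite ballEmdist /=; first by exists x.
    by move=> [_ ->].
  exact: fattening_open.
exists (CodeSeq.code [:: i; r]).
  apply/basic_ballP; rewrite /center_index /ball_radius !entry_code /= iy.
  by move: yx; rewrite ballEmdist /= metric_sym.
move=> p /eL pe; rewrite /finer /center_index /ball_radius !entry_code /=.
rewrite iy rmorphB /=; move: yx; rewrite ballEmdist /= => yx.
have := metric_triangle y x (a p.1).
rewrite (metric_sym y x) (metric_sym x (a p.1)); lra.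
Qed.

End ideal_points.

(** * The Prokhorov metric and ideal measures *)

Section measures.
Context (R : realType) (X : constructiveMetricType R).
Local Notation a := (@ideal_point R X).
Implicit Types (P Q : pmeas X) (A : set X) (e : R).

Lemma ball_fattening (x : X) e : ball x e = fattening [set x] e.
Proof.
apply/seteqP; split=> z; rewrite ballEmdist /=; first by exists x.
by move=> [_ ->].
Qed.

Lemma mball_open (x : X) e : open (ball x e).
Proof. by rewrite ball_fattening; exact: fattening_open. Qed.

Lemma mball_measurable (x : X) e : measurable (ball x e : set (borel X)).
Proof. by rewrite ball_fattening; exact: fattening_measurable. Qed.

Lemma open_measurableb A : open A -> measurable (A : set (borel X)).
Proof. by move=> oA; exact: sub_sigma_algebra. Qed.

Lemma lsc_measurable (f : borel X -> \bar R) :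
  (forall r : nat, open [set x : X | ((ratr (rat_of r))%:E < f x)%E]) ->
  measurable_fun [set: borel X] f.
Proof.
move=> of_; apply: (measurability _ (ErealGenOInfty.measurableE R)) => //.
move=> _ [_ [x ->] <-]; rewrite setTI.
have -> : f @^-1` `]x%:E, +oo[ =
    \bigcup_(r in [set r | x < ratr (rat_of r)]) [set y | ((ratr (rat_of r))%:E < f y)%E].
  apply/seteqP; split=> y /=; rewrite in_itv /= andbT.
    by move=> /rat_of_between_ereal[r [xr ry]]; exists r.
  by move=> [r /= xr ry]; apply: lt_trans ry; rewrite lte_fin.
by apply: bigcup_measurable => r _; apply: open_measurableb; exact: of_.
Qed.

Lemma pmeas_fineE P (A : set (borel X)) : measurable A -> P A = (fine (P A))%:E.
Proof. by move=> mA; rewrite fineK// fin_num_measure. Qed.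

Lemma basic_ball_measureP n P :
  basic_ball (@ideal_measure R X) n P <->
  prokhorov (ideal_measure X (center_index n)) P < ratr (ball_radius n).
Proof. by []. Qed.

Lemma prokhorov_measure_eq P Q e (S : pmeas X) :
  measure_eq P Q -> prokhorov S P < e -> prokhorov S Q < e.
Proof.
move=> PQ /prokhorov_ltP[d de SP]; apply/prokhorov_ltP; exists d => // A mA.
have [h1 h2] := SP A mA; rewrite -!PQ//; exact: fattening_measurable.
Qed.

Lemma basic_ball_measure_open n : open (basic_ball (@ideal_measure R X) n).
Proof.
rewrite openE => P /basic_ball_measureP/prokhorov_ltP[d /andP[d0 dn] nP].
apply/nbhs_ballP; exists (ratr (ball_radius n) - d) => /=; first by rewrite subr_gt0.
move=> Q /prokhorov_ltP[d' /andP[d'0 d'n] PQ]; apply/basic_ball_measureP.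
apply/prokhorov_ltP; exists (d + d'); last exact: prokhorov_le_trans nP PQ.
by rewrite addr_gt0//=; lra.
Qed.

(* Applying the bound to the complement of [fattening A e] gives the other half. *)
Lemma prokhorov_le_half P Q e :
  (forall A : set (borel X), measurable A -> (P A <= Q (fattening A e) + e%:E)%E) ->
  prokhorov_le P Q e.
Proof.
move=> PQ A mA; split; first exact: PQ.
have mF := @fattening_measurable R X A e.
have := PQ _ (measurableC mF).
have sub : fattening (~` fattening A e) e `<=` ~` A.
  by move=> x [y /= nAy yx] Ax; apply: nAy; exists x => //; rewrite metric_sym.
have QA : (Q (fattening (~` fattening A e) e) <= 1 - Q A)%E.
  rewrite -probability_setC//; apply: le_measure; rewrite ?inE//.
  - exact: fattening_measurable.
  - exact: measurableC.
move=> /le_trans /(_ (leeD2r _ QA)); rewrite probability_setC//.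
rewrite -(fineK (fin_num_measure P _ mF)) -(fineK (fin_num_measure Q _ mA)).
rewrite -!EFinB -!EFinD !lee_fin; lra.
Qed.

Lemma ideal_measureE n A : (0 < \sum_(p <- CodeSeq.decode n) entry p 1)%N ->
  ideal_measure X n A =
  ((\sum_(p <- CodeSeq.decode n) (entry p 1)%:R * (a (entry p 0) \in A)%:R) /
   (\sum_(p <- CodeSeq.decode n) entry p 1)%:R)%:E.
Proof.
move=> S0; rewrite /ideal_measure /= /mnormalize; set m := msum _ _.
have mE B : m B = (\sum_(p <- CodeSeq.decode n) (entry p 1)%:R * (a (entry p 0) \in B)%:R)%:E.
  rewrite /m /= /msum (big_nth 0%N) big_mkord -sumEFin; apply: eq_bigr => i _.
  transitivity (((entry (nth 0%N (CodeSeq.decode n) i) 1)%:R : R)%:E *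
    \d_(a (entry (nth 0%N (CodeSeq.decode n) i) 0) : borel X) B)%E => //.
have mT : m [set: borel X] = (\sum_(p <- CodeSeq.decode n) entry p 1)%:R%:E.
  rewrite mE natr_sum; congr EFin; apply: eq_bigr => p _.
  by rewrite in_setT mulr1.
case: ifPn => [/orP[]/eqP h|_].
- have := etrans (esym mT) h => -[/eqP]; rewrite pnatr_eq0.
  by rewrite (gtn_eqF S0).
- by have := etrans (esym mT) h.
transitivity (m A * (fine (m [set: borel X]))^-1%:E)%E => //.
by rewrite mT mE.
Qed.

Lemma ideal_points_cover (d : R) : 0 < d -> \bigcup_i ball (a i) d = [set: X].
Proof.
move=> d0; apply/seteqP; split=> // x _.
have [||y [yx [i _ iy]]] := @ideal_point_dense R X (ball x d).
- by exists x; exact: ballxx.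
- exact: mball_open.
by exists i => //; rewrite iy; exact: ball_sym.
Qed.

(** A tightness statement: balls of radius d around the dense sequence cover the space, so
    continuity from below leaves mass at most d outside finitely many of them. *)
Lemma ideal_points_mass P (d : R) : 0 < d -> exists N,
  ((1 - d)%:E <= P (\big[setU/set0]_(i < N) ball (a i) d : set (borel X)))%E.
Proof.
move=> d0; pose F n : set (borel X) := \big[setU/set0]_(i < n) ball (a i) d.
have mF n : measurable (F n).
  by apply: bigsetU_measurable => i _; exact: mball_measurable.
have FT : \bigcup_n F n = setT.
  apply/seteqP; split=> // x _.
  have : (\bigcup_i ball (a i) d) x by rewrite ideal_points_cover.
  move=> [i _ ix]; exists i.+1 => //.
  by rewrite /F big_ord_recr /=; right.
have := @nondecreasing_cvg_mu _ _ _ P F mF; rewrite FT.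
move=> /(_ measurableT) h.
have ndF : nondecreasing_seq F.
  move=> m n mn; apply/subsetPset; rewrite /F -!(bigcup_mkord _ (fun i => ball (a i) d)).
  by move=> x [i /= im ix]; exists i => //=; exact: leq_trans mn.
have PF : P (F n) @[n --> \oo] --> 1%E by rewrite -(probability_setT P); exact: h.
have : \forall n \near \oo, ((1 - d)%:E <= P (F n))%E.
  apply: lte_lim.
  - by move=> m n mn; apply: le_measure; rewrite ?inE//; exact/subsetPset/ndF.
  - exact: cvgP PF.
  - by rewrite (cvg_lim _ PF)// lte_fin ltrBlDr ltrDl.
by move=> [n _ nP]; exists n; apply: (nP n) => /=.
Qed.

(** The finitely many balls carrying almost all of P are cut into disjoint cells, and the mass of
    each cell, rounded down, is moved to the centre of its ball. *)
Lemma ideal_measure_dense P e : 0 < e -> exists2 n,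
  (0 < \sum_(p <- CodeSeq.decode n) entry p 1)%N &
  prokhorov (ideal_measure X n) P < e.
Proof.
(* With e at most 1, the total weight S satisfies S / M >= 1 - 2d >= 1/2, hence is positive and the
   normalisation does not fall back on its default. *)
wlog e1 : e / e <= 1.
  move=> H e0; have [||n n0 nP] := H (Num.min e 1).
  - by rewrite ge_min lexx orbT.
  - by rewrite lt_min e0 ltr01.
  by exists n => //; apply: (lt_le_trans nP); rewrite ge_min lexx.
(* The mass d outside the balls and the rounding loss d add up to e / 2; the radius d is below e / 2
   as well. *)
move=> e0; pose d := e / 4; have d0 : 0 < d by rewrite divr_gt0.
have [N PN] := ideal_points_mass P d0.
pose B i : set (borel X) := ball (a i) d.
pose E := seqDU B.
have mB i : measurable (B i) by exact: mball_measurable.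
have mE i : measurable (E i).
  by apply: measurableD => //; apply: bigsetU_measurable.
have tE : trivIset setT E by exact: trivIset_seqDU.
have EB : \big[setU/set0]_(i < N) E i = \big[setU/set0]_(i < N) B i.
  by rewrite -bigsetU_seqDU.
pose p i : R := fine (P (E i)).
have pE i : P (E i) = (p i)%:E by rewrite fineK// fin_num_measure.
have p0 i : 0 <= p i by rewrite fine_ge0.
have PE (I : pred 'I_N) : P (\big[setU/set0]_(i < N | I i) E i) = (\sum_(i < N | I i) p i)%:E.
  rewrite measure_bigsetU_ord_cond//; last first.
    by move=> i j _ _ ij; apply/val_inj; exact: (tE _ _ Logic.I Logic.I ij).
  by rewrite -sumEFin; apply: eq_bigr => i _; exact: pE.
(* Rounding N masses down to multiples of 1 / M loses at most N / M < d in all. *)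
pose M := (Num.truncn (N%:R / d)).+1.
have M0 : 0 < M%:R :> R by rewrite ltr0n.
have MN : N%:R / M%:R < d.
  by rewrite ltr_pdivrMr// mulrC -ltr_pdivrMr//; exact: truncnS_gt.
pose w i := Num.truncn (p i * M%:R).
have w_le i : (w i)%:R <= p i * M%:R.
  by rewrite truncn_le// mulr_ge0// ltW.
have w_gt i : p i * M%:R < (w i)%:R + 1.
  by rewrite natr1; exact: truncnS_gt.
pose n := CodeSeq.code [seq CodeSeq.code [:: i; w i] | i <- iota 0 N].
have sumE (G : nat -> nat -> R) :
    \sum_(q <- CodeSeq.decode n) G (entry q 0) (entry q 1) = \sum_(i < N) G i (w i).
  rewrite /n CodeSeq.codeK big_map -[N in iota 0 N]subn0 -/(index_iota 0 N) big_mkord.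
  by apply: eq_bigr => i _; rewrite !entry_code.
pose S := (\sum_(q <- CodeSeq.decode n) entry q 1)%N.
have SE : S%:R = \sum_(i < N) (w i)%:R :> R by rewrite natr_sum (sumE (fun _ x => x%:R)).
have sum_p : 1 - d <= \sum_(i < N) p i <= 1.
  rewrite -!lee_fin -(PE xpredT) EB PN /= probability_le1//.
  exact: bigsetU_measurable.
have sum_pw (I : pred 'I_N) :
    \sum_(i < N | I i) p i <= (\sum_(i < N | I i) (w i)%:R) / M%:R + d.
  rewrite (le_trans _ (lerD (lexx _) (ltW MN)))// -mulrDl ler_pdivlMr//.
  rewrite mulr_suml (@le_trans _ _ (\sum_(i < N | I i) ((w i)%:R + 1)))//.
    by apply: ler_sum => i _; exact: ltW.
  rewrite big_split /= lerD2l sumr_const ler_nat.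
  by rewrite (leq_trans (max_card _))// card_ord.
(* Since S is at most M, dividing by S rather than by M only enlarges the masses of the ideal
   measure, which is the favourable direction below. *)
have SM : S%:R <= M%:R :> R.
  rewrite SE (@le_trans _ _ (\sum_(i < N) p i * M%:R))//; first exact: ler_sum.
  by rewrite -mulr_suml; apply: ler_piMl; [exact: ltW|case/andP: sum_p].
have S0 : 0 < S%:R :> R.
  have := sum_pw xpredT; rewrite -SE.
  case/andP: sum_p => sp _ h.
  have : 0 < S%:R / M%:R :> R by move: sp h; rewrite /d; lra.
  by rewrite pmulr_lgt0// invr_gt0.
exists n; first by move: S0; rewrite ltr0n.
apply/prokhorov_ltP; exists (e / 2); first by apply/andP; split; lra.
apply: prokhorov_le_sym; apply: prokhorov_le_half => A mA.
have S0' : (0 < \sum_(q <- CodeSeq.decode n) entry q 1)%N by move: S0; rewrite ltr0n.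
rewrite ideal_measureE// (sumE (fun i x => x%:R * (a i \in fattening A (e / 2))%:R)) -/S.
(* The cells that meet A: each lies in a ball of radius d < e / 2, so its centre belongs to the
   fattening of A. *)
pose I (i : 'I_N) := `[< (A `&` E i) !=set0 >].
have Asub : A `<=` \big[setU/set0]_(i < N | I i) E i `|` ~` (\big[setU/set0]_(i < N) B i).
  move=> x Ax; have [|] := pselect ((\big[setU/set0]_(i < N) B i) x); last by right.
  rewrite -EB -bigcup_mkord => -[i /= iN Eix]; left.
  rewrite (bigD1 (Ordinal iN)) /=; first by left.
  by apply/asboolP; exists x.
apply: (@le_trans _ _ (P (\big[setU/set0]_(i < N | I i) E i) + d%:E)%E).
  have mI : measurable (\big[setU/set0]_(i < N | I i) E i) by exact: bigsetU_measurable.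
  have mBN : measurable (\big[setU/set0]_(i < N) B i) by exact: bigsetU_measurable.
  have mC := measurableC mBN.
  have PC : (P (~` (\big[setU/set0]_(i < N) B i)) <= d%:E)%E.
    have := PN; rewrite probability_setC// -/(B _) (pmeas_fineE P mBN).
    rewrite -EFinB !lee_fin; lra.
  apply: (@le_trans _ _ (P (\big[setU/set0]_(i < N | I i) E i `|`
      ~` (\big[setU/set0]_(i < N) B i)))).
    by apply: le_measure; rewrite ?inE//; exact: measurableU.
  apply: (le_trans (measureU2 P mI mC)).
  apply: leeD2l; exact: PC.
rewrite PE -!EFinD lee_fin.
have : \sum_(i < N | I i) p i <=
    (\sum_(i < N) (w i)%:R * (a i \in fattening A (e / 2))%:R) / S%:R + d.
  apply: (le_trans (sum_pw I)); rewrite lerD2r.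
  apply: ler_pM; rewrite ?invr_ge0 ?sumr_ge0//.
  - rewrite big_mkcond /=; apply: ler_sum => i _.
    rewrite /I; case: asboolP => [[y [Ay [Biy _]]]|_]; last by rewrite mulr_ge0.
    rewrite mem_set ?mulr1//; exists y => //.
    move: Biy; rewrite /B ballEmdist /= metric_sym => /lt_trans; apply.
    by rewrite /d; lra.
  - by rewrite lef_pV2 ?posrE.
rewrite /d; lra.
Qed.

End measures.

(** * Lower semicomputable functions *)

(* The library's open-cover form of compactness is stated for pointed spaces. *)
Section pointed_pmeas.
Context (R : realType) (X : constructiveMetricType R).
HB.instance Definition _ := isPointed.Build (pmeas X) (ideal_measure X 0).
End pointed_pmeas.

Section lower_semicomputable.
Context (R : realType) (X : constructiveMetricType R).
Local Notation a := (@ideal_point R X).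
Implicit Types (P Q : pmeas X) (C : set (pmeas X)).
Local Open Scope ereal_scope.

Lemma basic_ball_open n : open (basic_ball a n).
Proof. exact: mball_open. Qed.

Lemma lsc1_measurable (f : X -> \bar R) :
  lower_semicomputable f -> measurable_fun [set: borel X] (f : borel X -> \bar R).
Proof.
move=> [_ [W _ WE]]; apply: lsc_measurable => r; rewrite WE.
by apply: bigcup_open => n _; exact: basic_ball_open.
Qed.

Lemma lsc2_section (f : X -> pmeas X -> \bar R) P :
  lower_semicomputable2 f ->
  measurable_fun [set: borel X] (f^~ P : borel X -> \bar R).
Proof.
move=> [_ [W _ WE]]; apply: lsc_measurable => r.
have -> : [set x | (ratr (rat_of r))%:E < f x P] =
    \bigcup_(nm in [set nm | W [:: r; nm.1; nm.2] /\
      basic_ball (@ideal_measure R X) nm.2 P]) basic_ball a nm.1.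
  apply/seteqP; split=> x /=.
    move=> rf; have : [set xP | (ratr (rat_of r))%:E < f xP.1 xP.2] (x, P) by [].
    by rewrite WE => -[nm Wnm [/= nx mP]]; exists nm.
  move=> [nm [/= Wnm mP] nx].
  suff : [set xP | (ratr (rat_of r))%:E < f xP.1 xP.2] (x, P) by [].
  by rewrite WE; exists nm.
by apply: bigcup_open => n _; exact: basic_ball_open.
Qed.

(** Superlevel sets are unions of products with Prokhorov balls, and these do not separate measures
    that agree on Borel sets. *)
Lemma lsc2_measure_eq (f : X -> pmeas X -> \bar R) P Q x :
  lower_semicomputable2 f -> measure_eq P Q -> f x P = f x Q.
Proof.
move=> [f0 [W _ WE]] PQ.
have half (S S' : pmeas X) : measure_eq S S' -> f x S <= f x S'.
  move=> SS'; rewrite leNgt; apply/negP => lt_f.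
  have : f x S' \is a fin_num by rewrite ge0_fin_numE//; exact: lt_le_trans lt_f (leey _).
  move=> /fineK fS'; move: lt_f; rewrite -fS' => /rat_of_between_ereal[r [fr rf]].
  have : [set xP | (ratr (rat_of r))%:E < f xP.1 xP.2] (x, S) by [].
  rewrite WE => -[nm Wnm [/= nx mS]].
  have : [set xP | (ratr (rat_of r))%:E < f xP.1 xP.2] (x, S').
    by rewrite WE; exists nm => //; split=> //=; exact: prokhorov_measure_eq SS' mS.
  by rewrite /= -fS' lte_fin => /(lt_trans fr); rewrite ltxx.
by apply/eqP; rewrite eq_le !half// => A mA; rewrite PQ.
Qed.

Lemma lsc2_max (f g : X -> pmeas X -> \bar R) :
  lower_semicomputable2 f -> lower_semicomputable2 g ->
  lower_semicomputable2 (fun x P => maxe (f x P) (g x P)).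
Proof.
move=> [f0 [W eW WE]] [g0 [V eV VE]]; split.
  by move=> x P; rewrite le_max f0.
exists (fun v => W v \/ V v).
  by apply: semidec_enumerable; apply: semidec_or; exact: enumerable_semidec.
move=> r; apply/seteqP; split=> -[x P].
  rewrite /= lt_max => /orP[rf|rg].
    have : [set xP | (ratr (rat_of r))%:E < f xP.1 xP.2] (x, P) by [].
    by rewrite WE => -[nm Wnm nmP]; exists nm => //; left.
  have : [set xP | (ratr (rat_of r))%:E < g xP.1 xP.2] (x, P) by [].
  by rewrite VE => -[nm Wnm nmP]; exists nm => //; right.
move=> [nm [Wnm|Vnm] nmP]; rewrite /= lt_max; apply/orP.
  left; suff : [set xP | (ratr (rat_of r))%:E < f xP.1 xP.2] (x, P) by [].
  by rewrite WE; exists nm.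
right; suff : [set xP | (ratr (rat_of r))%:E < g xP.1 xP.2] (x, P) by [].
by rewrite VE; exists nm.
Qed.

Definition half_inf C (f : X -> pmeas X -> \bar R) (x : X) : \bar R :=
  2^-1%:E * ereal_inf [set f x Q | Q in C].

Lemma lte_half (r : R) (y : \bar R) : 0 <= y -> (r%:E < 2^-1%:E * y) = ((r + r)%:E < y).
Proof.
case: y => [y| |//] y0; last by rewrite gt0_muley ?lte_fin// !ltry.
by rewrite -EFinM !lte_fin; apply/idP/idP => ?; lra.
Qed.

(** A ball lies in the superlevel set when finitely many product balls on which f is large have
    measure balls covering C and first factors formally containing the given ball. Compactness
    supplies such a list, and effective compactness makes the covering condition enumerable. *)
Lemma half_inf_lsc C f : effectively_compact C -> lower_semicomputable2 f ->
  lower_semicomputable (half_inf C f).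
Proof.
move=> [cC ecC] [f0 [W eW WE]].
have inf0 x : 0 <= ereal_inf [set f x Q | Q in C].
  by apply: le_ereal_inf_tmp => _ [Q _ <-]; exact: f0.
split; first by move=> x; rewrite mule_ge0// lee_fin.
(* Here v lists the threshold r, a ball of X and more; u is a larger threshold, a ball of X and a
   ball of measures. *)
pose good (v : seq nat) (u : nat * nat * nat) :=
  [/\ (rat_of (nth 0%N v 0) + rat_of (nth 0%N v 0) < rat_of u.1.1)%R,
      W [:: u.1.1; u.1.2; u.2] &
      @finer R X (nth 0%N v 1) (center_index u.1.2) (ball_radius u.1.2)].
pose V v := exists L : seq (nat * nat * nat),
  (forall u, u \in L -> good v u) /\
  C `<=` \bigcup_(n in [set` map snd L]) basic_ball (@ideal_measure R X) n.
exists V.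
  apply: semidec_enumerable; apply: (semidec_ex (A := fun v L =>
    (forall u, u \in L -> good v u) /\
    C `<=` \bigcup_(n in [set` map snd L]) basic_ball (@ideal_measure R X) n)).
  apply: semidec_and; last first.
    apply: (semidec_comp (F := fun q : seq nat * seq (nat * nat * nat) => map snd q.2)
      (enumerable_semidec ecC)).
    by apply: (computable_map (F := fun _ => snd)); computability.
  apply: (semidec_all (A := fun q : seq nat * seq (nat * nat * nat) => good q.1)
    (L := fun q => q.2)); last by computability.
  have c0 i : computable (fun q : seq nat * seq (nat * nat * nat) * (nat * nat * nat) =>
      nth 0%N q.1.1 i).
    by apply: computable_nth; computability.
  have c1 : computable (fun q : seq nat * seq (nat * nat * nat) * (nat * nat * nat) =>
      q.2.1.2) by computability.
  apply: (@semidec_ext _ _ (fun q : seq nat * seq (nat * nat * nat) * (nat * nat * nat) =>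
      (rat_of (nth 0%N q.1.1 0) + rat_of (nth 0%N q.1.1 0) < rat_of q.2.1.1)%R /\
      (W [:: q.2.1.1; q.2.1.2; q.2.2] /\
      @finer R X (nth 0%N q.1.1 1) (center_index q.2.1.2) (ball_radius q.2.1.2)))).
    by move=> q; split=> [[? []]|[]].
  apply: semidec_and.
    apply: semidec_computable; apply: computableq_lt.
      by apply: computableq_add; exact/computableq_rat_of/c0.
    by apply: computableq_rat_of; computability.
  apply: semidec_and.
    apply: (semidec_comp (F := fun q : seq nat * seq (nat * nat * nat) * (nat * nat * nat) =>
      [:: q.2.1.1; q.2.1.2; q.2.2]) (enumerable_semidec eW)).
    by computability.
  apply: semidec_mdist_lt; [exact/computable_center_index/c0|exact: computable_center_index|].
  apply: computableq_add; first exact: computableq_ball_radius.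
  exact/computableq_opp/computableq_ball_radius/c0.
move=> r; apply/seteqP; split=> x /=.
  rewrite /half_inf lte_half// => rf.
  pose D := [set u : nat * nat * nat |
    [/\ (ratr (rat_of r) + ratr (rat_of r) < ratr (rat_of u.1.1) :> R)%R,
        W [:: u.1.1; u.1.2; u.2] & basic_ball a u.1.2 x]].
  have := cC; rewrite compact_cover.
  move=> /(_ _ D (fun u => basic_ball (@ideal_measure R X) u.2)).
  case=> [u _|Q CQ|D' D'D CD'].
  - exact: basic_ball_measure_open.
  - have : (ratr (rat_of r) + ratr (rat_of r))%:E < f x Q.
      by apply: (lt_le_trans rf); apply: ereal_inf_lbound; exists Q.
    move=> /rat_of_between_ereal[r' [rr' r'f]].
    have : [set xP | (ratr (rat_of r'))%:E < f xP.1 xP.2] (x, Q) by [].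
    by rewrite WE => -[[n m] /= Wnm [/= nx mQ]]; exists (r', n, m).
  have [|n nx nL] := @ball_refine R X x
      [seq (center_index u.1.2, ball_radius u.1.2) | u <- finmap.enum_fset D'].
    move=> _ /mapP[u uD' ->] /=.
    by have /set_mem[_ _ /basic_ballP] := D'D _ uD'.
  exists n => //; exists (finmap.enum_fset D'); split.
    move=> u uD'; have /set_mem[ru Wu ux] := D'D _ uD'; split=> //=.
      by rewrite -(ltr_rat R) rmorphD.
    by apply: (nL (_, _)); apply/mapP; exists u.
  move=> Q /CD'[u /= uD' uQ]; exists u.2 => //=.
  by apply/mapP; exists u.
move=> [n [L [Lgood Lcov]] nx]; rewrite /half_inf lte_half//.
(* Values above 2r could still have infimum 2r; the least of the finitely many thresholds keeps the
   inequality strict. For the empty list, which covers only an empty C, any y above 2r will do. *)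
have [y ry yL] : exists2 y : R, (ratr (rat_of r) + ratr (rat_of r) < y)%R &
    forall u, u \in L -> (y <= ratr (rat_of u.1.1))%R.
  have rL u : u \in L -> (ratr (rat_of r) + ratr (rat_of r) < ratr (rat_of u.1.1) :> R)%R.
    by move=> /Lgood[/= + _ _]; rewrite -(ltr_rat R) rmorphD.
  elim: L rL {Lgood Lcov} => [_|u L IH rL].
    by exists (ratr (rat_of r) + ratr (rat_of r) + 1)%R; rewrite ?ltrDl.
  have [|y ry yL] := IH; first by move=> v vL; apply: rL; rewrite inE vL orbT.
  exists (Num.min y (ratr (rat_of u.1.1))); first by rewrite lt_min ry rL// mem_head.
  move=> v; rewrite inE => /orP[/eqP->|/yL yv]; first by rewrite ge_min lexx orbT.
  by rewrite ge_min yv.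
apply: (@lt_le_trans _ _ y%:E); first by rewrite lte_fin.
apply: le_ereal_inf_tmp => _ [Q CQ <-].
have [_ /= /mapP[u uL ->] uQ] := Lcov _ CQ.
have [ru Wu un] := Lgood _ uL.
apply: (@le_trans _ _ (ratr (rat_of u.1.1))%:E); first by rewrite lee_fin yL.
apply: ltW; suff : [set xP | (ratr (rat_of u.1.1))%:E < f xP.1 xP.2] (x, Q) by [].
rewrite WE; exists (u.1.2, u.2) => //; split=> //=.
by apply/basic_ballP; exact: finer_sub un nx.
Qed.

End lower_semicomputable.

(** * Trimming *)

Section trimming.
Context d (T : measurableType d) (R : realType) (P : {measure set T -> \bar R}).
Local Open Scope ereal_scope.

(* The bound [c] passes to the supremum of the [F n], [n] in [S], because the
   [F n] increase: it is the limit of the last [F n] seen, n in S. *)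
Lemma integral_sup_trimmed (F : nat -> T -> \bar R) (S : nat -> Prop) (c : \bar R) :
  (forall n, measurable_fun setT (F n)) -> (forall n x, 0 <= F n x) ->
  (forall n x, F n x <= F n.+1 x) -> 0 <= c ->
  (forall n, S n -> \int[P]_x F n x <= c) ->
  exists G : T -> \bar R, [/\ measurable_fun setT G,
    forall x, 0 <= G x, forall n x, S n -> F n x <= G x & \int[P]_x G x <= c].
Proof.
move=> mF F0 ndF c0 Fc.
pose g : nat -> T -> \bar R := nat_rect (fun=> T -> \bar R) (cst 0)
  (fun n gn => if `[< S n >] then F n else gn).
have mg n : measurable_fun setT (g n).
  by elim: n => [|n IH] /=; [exact: measurable_cst|case: ifP].
have g0 n x : 0 <= g n x by elim: n => [|n IH] //=; case: ifP.
have gF n x : g n x <= F n x.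
  elim: n => [|n IH] /=; first exact: F0.
  by case: ifP => // _; exact: le_trans IH (ndF _ _).
have ndg x : nondecreasing_seq (g ^~ x).
  by apply/nondecreasing_seqP => n /=; case: ifP => // _; exact: gF.
have intg n : \int[P]_x g n x <= c.
  elim: n => [|n IH] /=; first by rewrite integral0.
  by case: asboolP => // /Fc.
have cvg x : cvgn (g ^~ x) by exact: ereal_nondecreasing_is_cvgn.
exists (fun x => limn (g ^~ x)); split.
- by apply: (@emeasurable_fun_cvg _ _ _ setT g) => // x _; exact: cvg.
- by move=> x; apply: lime_ge => //; apply: nearW.
- move=> n x Sn; apply: (@le_trans _ _ (g n.+1 x)).
    by rewrite /=; case: asboolP.
  rewrite (cvg_lim _ (ereal_nondecreasing_cvgn (ndg x)))//.
  by apply: ereal_sup_ubound; exists n.+1.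
- rewrite monotone_convergence//.
  apply: lime_le.
    apply: ereal_nondecreasing_is_cvgn => m n mn; apply: ge0_le_integral => //.
    by move=> x _; exact: ndg.
  exact: nearW.
Qed.

End trimming.

(** * Sums of powers of two *)

Section geometric_sums.
Context (R : realType).

Lemma sum_exp2 n : \sum_(k < n) 2 ^+ k <= 2 ^+ n :> R.
Proof.
elim: n => [|n IH]; first by rewrite big_ord0.
by rewrite big_ord_recr /= exprS; lra.
Qed.

(** A geometric sum is controlled by its last term: if 2^n < y, then the earlier terms add up to at
    most 2^n. *)
Lemma sum_exp2_lt n (y : R) : 0 <= y ->
  \sum_(k < n) 2 ^+ k * (2 ^+ k < y)%R%:R <= 2 * y.
Proof.
move=> y0; elim: n => [|n IH]; first by rewrite big_ord0 mulr_ge0.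
rewrite big_ord_recr /=; case: ltP => [ny|_]; last by rewrite mulr0 addr0.
rewrite mulr1; have := @sum_exp2 n.
have : \sum_(k < n) 2 ^+ k * (2 ^+ k < y)%R%:R <= \sum_(k < n) 2 ^+ k :> R.
  by apply: ler_sum => k _; rewrite ler_piMr// lern1 leq_b1.
lra.
Qed.

End geometric_sums.

(** * A uniform test that dominates a class test *)

Section uniform_of_class.
Context (R : realType) (X : constructiveMetricType R).
Local Notation a := (@ideal_point R X).
Context (C : set (pmeas X)) (tC : X -> \bar R) (W : set (seq nat)).
(* [p] enumerates the balls of [U k := tC > 2 ^ k] in stages; [D] approximates
   the distances of ideal points. *)
Context (p : seq nat -> nat -> bool) (D : nat * nat * nat -> rat).
Context (tC0 : forall x, (0 <= tC x)%E).
Context (tC_int : forall P : pmeas X, C P ->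
  (\int[P]_x (tC : borel X -> \bar R) x <= 1)%E).
Context (tC_meas : measurable_fun [set: borel X] (tC : borel X -> \bar R)).
Context (WE : forall r : nat, [set x | ((ratr (rat_of r))%:E < tC x)%E] =
  \bigcup_(n in [set n | W [:: r; n]]) basic_ball a n).
Context (pW : forall v, W v <-> exists j, p v j).
Context (DP : forall i j k, `|mdist (a i) (a j) - ratr (D (i, j, k))| <= 2 ^- k).

Definition pow2_code (k : nat) : nat := CodeSeq.code [:: 2 ^ k; 0; 0]%N.

Lemma rat_of_pow2 k : rat_of (pow2_code k) = 2 ^+ k.
Proof. by rewrite /rat_of !entry_code /= subr0 divr1 natrX. Qed.

Definition listed (n k b : nat) : bool := has (p [:: pow2_code k; b]) (iota 0 n).

(** The value may be negative; the corresponding ball is then empty. *)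
Definition shrunk (n b : nat) : rat := ball_radius b - 2 ^- n.

Definition stage (n k : nat) : set X :=
  [set x | exists b, [/\ (b < n)%N, listed n k b &
     mdist (a (center_index b)) x < ratr (shrunk n b)]].

(** The radius [shrunk n.+1] lies halfway between the radius used in [stage n] and the full one,
    with a margin of 2^-(n+1) on either side. Each margin pays for one approximation error 2^-(n+2)
    and one displacement of 2^-(n+2); hence [stage_hit] and [hit_sub]. *)
Definition hit (n k i : nat) : bool := has (fun b => listed n k b &&
  (D (i, center_index b, n.+2) < shrunk n.+1 b)) (iota 0 n).

Definition hit_weight (n i : nat) : nat := (\sum_(k < n) 2 ^ k * hit n k i)%N.

(* [cert n m] ensures that every measure in the ball m gives an integral at most 4
   to the sum over k < n of the functions 2 ^ k * \1_(stage n k). *)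
Definition cert (n m : nat) : bool :=
  [&& (0 < \sum_(q <- CodeSeq.decode (center_index m)) entry q 1)%N,
      (\sum_(q <- CodeSeq.decode (center_index m)) entry q 1 * hit_weight n (entry q 0) <=
       3 * \sum_(q <- CodeSeq.decode (center_index m)) entry q 1)%N &
      ball_radius m <= 2 ^- n.+2].

Lemma listed_sub n k b x : listed n k b -> basic_ball a b x -> ((2 ^+ k)%:E < tC x)%E.
Proof.
move=> /hasP[j _ pj] bx; have kW : W [:: pow2_code k; b] by apply/pW; exists j.
have : [set x | ((ratr (rat_of (pow2_code k)))%:E < tC x)%E] x by rewrite WE; exists b.
by rewrite /= rat_of_pow2 rmorphXn /= ratr_nat.
Qed.

Lemma listedP k x : ((2 ^+ k)%:E < tC x)%E ->
  exists b n0, basic_ball a b x /\ forall n, (n0 <= n)%N -> listed n k b.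
Proof.
move=> kx; have : [set x | ((ratr (rat_of (pow2_code k)))%:E < tC x)%E] x.
  by rewrite /= rat_of_pow2 rmorphXn /= ratr_nat.
rewrite WE => -[b /= /pW[j pj] bx]; exists b, j.+1; split=> // n jn.
by apply/hasP; exists j => //; rewrite mem_iota.
Qed.

Lemma ratr_exp2N n : ratr (2 ^- n) = 2 ^- n :> R.
Proof. by rewrite fmorphV rmorphXn /= ratr_nat. Qed.

Lemma exp2N_S n : 2 ^- n.+1 = 2 ^- n / 2 :> R.
Proof. by rewrite exprS invfM mulrC. Qed.

Lemma stage_mono n k : stage n k `<=` stage n.+1 k.
Proof.
move=> x [b [bn lb bx]]; exists b; split; first exact: leqW.
  move: lb => /hasP[j jn pj]; apply/hasP; exists j => //; move: jn.
  by rewrite !mem_iota /= !add0n => /leqW.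
apply: (lt_le_trans bx); rewrite /shrunk !rmorphB /= !ratr_exp2N exp2N_S.
have : 0 < 2 ^- n :> R by rewrite invr_gt0 exprn_gt0.
lra.
Qed.

Lemma stage_open n k : open (stage n k).
Proof.
have -> : stage n k = \bigcup_(b in [set b | (b < n)%N && listed n k b])
    ball (a (center_index b)) (ratr (shrunk n b)).
  apply/seteqP; split=> x; first by move=> [b [bn lb bx]]; exists b; rewrite /= ?bn// ballEmdist.
  by move=> [b /= /andP[bn lb]]; rewrite ballEmdist /= => bx; exists b.
by apply: bigcup_open => b _; exact: mball_open.
Qed.

Lemma stage_measurable n k : measurable (stage n k : set (borel X)).
Proof. by apply: open_measurableb; exact: stage_open. Qed.

Lemma stage_hit n k x i (e : R) : stage n k x -> mdist x (a i) < e ->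
  e <= 2 ^- n.+2 -> hit n k i.
Proof.
move=> [b [bn lb bx]] xi en; apply/hasP; exists b; first by rewrite mem_iota.
rewrite lb /= -(ltr_rat R).
have := DP i (center_index b) n.+2; rewrite ler_norml => /andP[+ _].
have := metric_triangle (a i) x (a (center_index b)).
rewrite (metric_sym (a i) x) (metric_sym x (a (center_index b))).
move: bx en; rewrite /shrunk !rmorphB /= !ratr_exp2N !exp2N_S; lra.
Qed.

Lemma hit_sub n k i x : hit n k i -> mdist (a i) x < 2 ^- n.+2 ->
  ((2 ^+ k)%:E < tC x)%E.
Proof.
move=> /hasP[b _ /andP[lb]]; rewrite -(ltr_rat R) => Db ix.
apply: (listed_sub lb); apply/basic_ballP.
have := DP i (center_index b) n.+2; rewrite ler_norml => /andP[_].
have := metric_triangle (a (center_index b)) (a i) x.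
rewrite (metric_sym (a (center_index b)) (a i)).
move: Db ix; rewrite /shrunk !rmorphB /= !ratr_exp2N !exp2N_S; lra.
Qed.

(** * Integrals over the stages; soundness and completeness of certificates *)

Definition stage_sum (n : nat) (x : borel X) : \bar R :=
  (\sum_(k < n) (2 ^+ k)%:E * (\1_(stage n k) x)%:E)%E.

Lemma stage_sum_measurable n : measurable_fun [set: borel X] (stage_sum n).
Proof.
apply: emeasurable_sum => k; apply: measurable_funeM.
by apply/measurable_EFinP; apply: measurable_indic; exact: stage_measurable.
Qed.

Lemma stage_sum_ge0 n x : (0 <= stage_sum n x)%E.
Proof. by apply: sume_ge0 => k _; rewrite mule_ge0// lee_fin ?exprn_ge0. Qed.

Lemma stage_sum_mono n x : (stage_sum n x <= stage_sum n.+1 x)%E.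
Proof.
rewrite /stage_sum big_ord_recr /= -[leLHS]adde0; apply: leeD.
  apply: lee_sum => k _; apply: lee_pmul; rewrite ?lee_fin ?exprn_ge0//.
  rewrite !indicE ler_nat; case: (boolP (x \in stage n k)) => // /set_mem nx.
  by rewrite mem_set//; exact: stage_mono.
by rewrite mule_ge0// lee_fin ?exprn_ge0.
Qed.

Lemma stage_sum_integral n (P : pmeas X) :
  (\int[P]_x stage_sum n x = \sum_(k < n) (2 ^+ k)%:E * P (stage n k))%E.
Proof.
rewrite /stage_sum ge0_integral_sum//; last first.
  move=> k; apply: measurable_funeM.
  by apply/measurable_EFinP; apply: measurable_indic; exact: stage_measurable.
apply: eq_bigr => k _; rewrite ge0_integralZl_EFin ?exprn_ge0//.
- by rewrite integral_indic ?setIT//; exact: stage_measurable.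
- by apply/measurable_EFinP; apply: measurable_indic; exact: stage_measurable.
Qed.

Lemma hit_weight_sum n (L : seq nat) :
  (\sum_(q <- L) entry q 1 * hit_weight n (entry q 0) =
   \sum_(k < n) 2 ^ k * \sum_(q <- L) entry q 1 * hit n k (entry q 0))%N.
Proof.
transitivity (\sum_(q <- L) \sum_(k < n) 2 ^ k * (entry q 1 * hit n k (entry q 0)))%N.
  apply: eq_bigr => q _; rewrite /hit_weight big_distrr /=.
  by apply: eq_bigr => k _; rewrite mulnCA.
rewrite exchange_big /=; apply: eq_bigr => k _.
by rewrite big_distrr.
Qed.

(** Moving from the ideal measure to P fattens each stage by d, which only reaches hit points, and
    adds d to its mass. The weighted errors sum to at most 1, on top of the certified 3. *)
Lemma cert_sound n m (P : pmeas X) : cert n m ->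
  basic_ball (@ideal_measure R X) m P -> (\int[P]_x stage_sum n x <= 4%:E)%E.
Proof.
move=> /and3P[S0 hS em] /basic_ball_measureP/prokhorov_ltP[d /andP[d0 dm] mP].
have {}em : ratr (ball_radius m) <= 2 ^- n.+2 :> R by rewrite -ratr_exp2N ler_rat.
set L := CodeSeq.decode (center_index m) in S0 hS *.
set S := (\sum_(q <- L) entry q 1)%N in S0 hS *.
have SR0 : 0 < S%:R :> R by rewrite ltr0n.
pose hw k : nat := (\sum_(q <- L) entry q 1 * hit n k (entry q 0))%N.
have Pk (k : 'I_n) : (P (stage n k) <= ((hw k)%:R / S%:R + d)%:E)%E.
  have [_ Pst] := mP _ (stage_measurable n k).
  apply: (le_trans Pst); rewrite EFinD leeD2r// ideal_measureE// lee_fin.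
  rewrite ler_pM2r ?invr_gt0// natr_sum; apply: ler_sum => q _.
  rewrite natrM; apply: ler_wpM2l => //; rewrite ler_nat.
  case: (boolP (_ \in _)) => // /set_mem[x xst xq].
  rewrite (stage_hit xst xq)//; exact: le_trans (ltW dm) em.
rewrite stage_sum_integral.
apply: (@le_trans _ _ (\sum_(k < n) (2 ^+ k * ((hw k)%:R / S%:R + d))%:E)%E).
  by apply: lee_sum => k _; rewrite EFinM lee_pmul2l// lte_fin exprn_gt0.
rewrite sumEFin lee_fin.
have -> : \sum_(k < n) 2 ^+ k * ((hw k)%:R / S%:R + d) =
    (\sum_(q <- L) entry q 1 * hit_weight n (entry q 0))%N%:R / S%:R + (\sum_(k < n) 2 ^+ k) * d.
  rewrite (eq_bigr (fun k : 'I_n => (2 ^ k * hw k)%N%:R / S%:R + 2 ^+ k * d)).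
    by rewrite big_split /= -!mulr_suml -natr_sum -hit_weight_sum.
  by move=> k _; rewrite natrM natrX mulrDr mulrA.
have h3 : (\sum_(q <- L) entry q 1 * hit_weight n (entry q 0))%N%:R / S%:R <= 3 :> R.
  by rewrite ler_pdivrMr// -natrM ler_nat.
(* The radius bound in [cert] gives 2^n * 2^-(n+2) = 1/4. *)
have h1 : (\sum_(k < n) 2 ^+ k) * d <= 1.
  apply: (@le_trans _ _ (2 ^+ n * 2 ^- n.+2)).
    apply: ler_pM; rewrite ?sumr_ge0 ?sum_exp2 ?(ltW d0)//.
    exact: le_trans (ltW dm) em.
  rewrite -(addn2 n) exprD invfM mulrA divff ?mul1r ?expf_neq0//.
  by rewrite invf_le1 ?exprn_gt0// exprn_ege1// ler1n.
lra.
Qed.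

Lemma superlevel_measurable k :
  measurable ([set x | ((2 ^+ k)%:E < tC x)%E] : set (borel X)).
Proof.
have := tC_meas measurableT (emeasurable_itv `](2 ^+ k)%:E, +oo[).
rewrite setTI; congr measurable; apply/seteqP.
by split=> x /=; rewrite in_itv /= andbT.
Qed.

(** Pointwise, the powers 2^k below [tC x] add up to at most twice [tC x], and the integral of [tC]
    is at most 1. *)
Lemma superlevel_sum (P : pmeas X) n : C P ->
  (\sum_(k < n) (2 ^+ k)%:E * P [set x | ((2 ^+ k)%:E < tC x)%E] <= 2%:E)%E.
Proof.
move=> CP; pose U k : set (borel X) := [set x | ((2 ^+ k)%:E < tC x)%E].
have mU k : measurable (U k) by exact: superlevel_measurable.
have m1 k : measurable_fun [set: borel X] (fun x => ((2 ^+ k)%:E * (\1_(U k) x)%:E)%E : \bar R).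
  by apply: measurable_funeM; apply/measurable_EFinP; exact: measurable_indic.
have <- : (\int[P]_x (\sum_(k < n) (2 ^+ k)%:E * (\1_(U k) x)%:E) =
    \sum_(k < n) (2 ^+ k)%:E * P (U k))%E.
  rewrite ge0_integral_sum//.
  apply: eq_bigr => k _; rewrite ge0_integralZl_EFin ?exprn_ge0//.
  - by rewrite integral_indic ?setIT.
  - by apply/measurable_EFinP; exact: measurable_indic.
apply: (@le_trans _ _ (\int[P]_x (2%:E * tC x))%E).
  have mS : measurable_fun [set: borel X]
      (fun x => (\sum_(k < n) (2 ^+ k)%:E * (\1_(U k) x)%:E)%E : \bar R).
    exact: emeasurable_sum.
  have m2 : measurable_fun [set: borel X] (fun x => (2%:E * tC x)%E) by exact: measurable_funeM.
  apply: ge0_le_integral => //.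
    by move=> x _; apply: sume_ge0 => k _; rewrite mule_ge0// lee_fin ?exprn_ge0.
  move=> x _; have := tC0 x; rewrite /U; case E: (tC x) => [y| |//] y0; last first.
    by rewrite gt0_muley ?lte_fin// leey.
  rewrite -EFinM; apply: (@le_trans _ _ (\sum_(k < n) 2 ^+ k * (2 ^+ k < y)%R%:R)%:E).
    rewrite -sumEFin; apply: lee_sum => k _; rewrite -EFinM lee_fin.
    apply: ler_wpM2l; rewrite ?exprn_ge0// indicE ler_nat.
    by case: (boolP (_ \in _)) => // /set_mem /=; rewrite E lte_fin => ->.
  by rewrite lee_fin sum_exp2_lt.
rewrite ge0_integralZl_EFin//.
by rewrite -[leRHS]mule1 lee_pmul2l// tC_int.
Qed.

(** For an ideal measure close enough to P, the hit points weigh at most as much as U_k under P plus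
    d; the weighted total is at most 2 + 1 = 3, the threshold in [cert]. *)
Lemma cert_complete (P : pmeas X) n : C P ->
  exists2 m, cert n m & basic_ball (@ideal_measure R X) m P.
Proof.
(* Half of the displacement allowed by [hit_sub]: one half fattens the hit points to an open, hence
   measurable, set, the other absorbs the Prokhorov distance. *)
move=> CP; pose e : R := 2 ^- n.+2 / 2.
have e0 : 0 < e by rewrite divr_gt0// invr_gt0 exprn_gt0.
have [r re] := posrat_of_small e0.
have r0 : 0 < ratr (posrat_of r) :> R by rewrite ltr0q posrat_of_gt0.
have [j S0 jP] := ideal_measure_dense P r0.
pose m := CodeSeq.code [:: j; r].
have mj : center_index m = j by rewrite /center_index entry_code.
have mr : ball_radius m = posrat_of r by rewrite /ball_radius entry_code.
exists m; last by apply/basic_ball_measureP; rewrite mj mr.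
rewrite /cert mj mr S0 /=; apply/andP; split; last first.
  by rewrite -(ler_rat R) ratr_exp2N; move: re e0; rewrite /e; lra.
move: jP => /prokhorov_ltP[d /andP[d0 dr] jP].
set L := CodeSeq.decode j in S0 *; set S := (\sum_(q <- L) entry q 1)%N in S0 *.
have SR0 : 0 < S%:R :> R by rewrite ltr0n.
pose hw k : nat := (\sum_(q <- L) entry q 1 * hit n k (entry q 0))%N.
pose H k : set X := [set x | exists i, hit n k i /\ x = a i].
pose U k : set (borel X) := [set x | ((2 ^+ k)%:E < tC x)%E].
have kU (k : 'I_n) : (((hw k)%:R / S%:R)%:E <= P (U k) + d%:E)%E.
  have [Pst _] := jP _ (@fattening_measurable R X (H k) e).
  apply: (@le_trans _ _ (ideal_measure X j (fattening (H k) e))).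
    rewrite ideal_measureE// lee_fin ler_pM2r ?invr_gt0// natr_sum.
    apply: ler_sum => q _; rewrite natrM; apply: ler_wpM2l => //; rewrite ler_nat.
    case: (boolP (hit _ _ _)) => // hq; rewrite mem_set//.
    by apply: sub_fattening => //; exists (entry q 0).
  apply: (le_trans Pst); rewrite leeD2r//; apply: le_measure; rewrite ?inE.
  - exact: fattening_measurable.
  - exact: superlevel_measurable.
  move=> x [y [_ [i [hi ->]] iy] yx]; apply: (hit_sub hi).
  apply: (le_lt_trans (metric_triangle _ y _)).
  by move: iy yx re dr; rewrite /e; lra.
rewrite -(ler_nat R) natrM -ler_pdivrMr//.
rewrite hit_weight_sum natr_sum mulr_suml.
rewrite -lee_fin -sumEFin.
apply: (@le_trans _ _ (\sum_(k < n) ((2 ^+ k)%:E * P (U k) + (2 ^+ k * d)%:E))%E).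
  apply: lee_sum => k _; rewrite natrM natrX -mulrA EFinM.
  rewrite [((_ * d)%:E)%E]EFinM -ge0_muleDr ?lee_fin ?(ltW d0)//.
  by rewrite lee_pmul2l// ?lte_fin ?exprn_gt0// kU.
rewrite big_split /= sumEFin.
apply: (le_trans (leeD (superlevel_sum n CP) (lexx _))).
rewrite -EFinD lee_fin -mulr_suml.
have : (\sum_(k < n) 2 ^+ k) * d <= 1.
  apply: (@le_trans _ _ (2 ^+ n * 2 ^- n.+2)).
    apply: ler_pM; rewrite ?sumr_ge0 ?sum_exp2 ?(ltW d0)//.
    by move: dr re e0; rewrite /e; lra.
  rewrite -(addn2 n) exprD invfM mulrA divff ?mul1r ?expf_neq0//.
  by rewrite invf_le1 ?exprn_gt0// exprn_ege1// ler1n.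
lra.
Qed.

Definition dominating_set (x : X) (P : pmeas X) : set (\bar R) :=
  [set y | exists k n m, [/\ (k < n)%N, cert n m,
    basic_ball (@ideal_measure R X) m P, stage n k x & y = (2 ^+ k)%:E]].

(** The element 1 covers the values of [tC] below the dyadic thresholds. The integral of the
    supremum is at most 1 + 4, so the factor 1/8 suffices. *)
Definition dominating (x : X) (P : pmeas X) : \bar R :=
  (8^-1%:E * ereal_sup ([set 1] `|` dominating_set x P))%E.

Lemma dominating_sup_ge1 x P : (1 <= ereal_sup ([set 1] `|` dominating_set x P))%E.
Proof. by apply: ereal_sup_ubound; left. Qed.

Lemma dominating_ge0 x P : (0 <= dominating x P)%E.
Proof. by rewrite mule_ge0// (le_trans _ (dominating_sup_ge1 x P)). Qed.

Lemma lte_eighth (r : R) (y : \bar R) : (1 <= y)%E ->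
  (r%:E < 8^-1%:E * y)%E = ((8 * r)%:E < y)%E.
Proof.
case: y => [y| |//] y0; last by rewrite gt0_muley ?lte_fin// !ltry.
by rewrite -EFinM !lte_fin; apply/idP/idP => ?; lra.
Qed.

(** Rounding to powers of two loses a factor 2, and undoing the normalisation a factor 8. If [tC x]
    exceeded twice the supremum y, the first power of two above y would still be below [tC x], and a
    certified late stage would put it in the set. *)
Lemma dominating_ub x P : C P -> (tC x <= 16%:E * dominating x P)%E.
Proof.
move=> CP; rewrite /dominating muleA -EFinM.
have -> : 16 * 8^-1 = 2 :> R by lra.
set s := ereal_sup _; have s1 : (1 <= s)%E by exact: dominating_sup_ge1.
rewrite leNgt; apply/negP; case E: s s1 => [y| |//]; last first.
  by move=> _; rewrite gt0_muley ?lte_fin// ltNge leey.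
rewrite lee_fin -EFinM => y1 yt.
have ex : exists k, y < 2 ^+ k.
  exists (Num.truncn y).+1; apply: (lt_le_trans (truncnS_gt y)).
  by rewrite -natrX ler_nat ltnW// ltn_expl.
case: (ex_minnP ex) => -[|k] yk kmin; first by move: yk; rewrite expr0 ltNge y1.
have ky : 2 ^+ k <= y by rewrite leNgt; apply/negP => /kmin; rewrite ltnn.
have kt : ((2 ^+ k.+1)%:E < tC x)%E.
  by apply: le_lt_trans yt; rewrite lee_fin exprS ler_pM2l.
have [b [n0 [/basic_ballP bx lb]]] := listedP kt.
have [n1 n1P] : exists n1, 2 ^- n1 < ratr (ball_radius b) - mdist (a (center_index b)) x.
  by apply: exp2N_small; rewrite subr_gt0.
(* Late enough for k+1 to be among the summands, for the ball b to be within range and listed, and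
   for the shrinking to spare x. *)
pose n := maxn (maxn k.+2 b.+1) (maxn n0 n1).
have kn : (k.+1 < n)%N by rewrite /n !leq_max leqnn.
have bn : (b < n)%N by rewrite /n !leq_max leqnn !orbT.
have n0n : (n0 <= n)%N by rewrite /n !leq_max leqnn !orbT.
have n1n : (n1 <= n)%N by rewrite /n !leq_max leqnn !orbT.
have xst : stage n k.+1 x.
  exists b; split=> //; first exact: lb.
  rewrite /shrunk rmorphB /= ratr_exp2N.
  have : 2 ^- n <= 2 ^- n1 :> R.
    by rewrite lef_pV2 ?posrE ?exprn_gt0// ler_weXn2l// ler1n.
  lra.
have [m cm mP] := cert_complete n CP.
have : ((2 ^+ k.+1)%:E <= s)%E by apply: ereal_sup_ubound; right; exists k.+1, n, m.
by rewrite E lee_fin leNgt yk.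
Qed.

(** * Computability of certificates and lower semicomputability *)

Context (cp : computableb (fun q : seq nat * nat => p q.1 q.2)) (cD : computableq D).

Lemma computable_listed :
  computableb (fun q : nat * nat * nat => listed q.1.1 q.1.2 q.2).
Proof.
apply: (computable_has_iota (p := fun q : nat * nat * nat => p [:: pow2_code q.1.2; q.2])
  (F := fun q => q.1.1)); first by computability.
apply: (computable_comp cp (F := fun q : nat * nat * nat * nat =>
  ([:: pow2_code q.1.1.2; q.1.2], q.2))).
apply: computable_pair; last by computability.
apply: computable_cons; last by computability.
by apply: computable_code; computability.
Qed.

Lemma computableq_shrunk T {eT : encodable T} (F G : T -> nat) :
  computable F -> computable G -> computableq (fun t => shrunk (F t) (G t)).
Proof.
move=> cF cG; apply: computableq_add; first exact: computableq_ball_radius.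
by apply: computableq_opp; exact: computableq_exp2N.
Qed.

Lemma computable_hit : computableb (fun q : nat * nat * nat => hit q.1.1 q.1.2 q.2).
Proof.
apply: (computable_has_iota (p := fun (q : nat * nat * nat) b => listed q.1.1 q.1.2 b &&
  (D (q.2, center_index b, q.1.1.+2) < shrunk q.1.1.+1 b)) (F := fun q => q.1.1)).
  by computability.
apply: (computable_and (T := nat * nat * nat * nat)).
  apply: (computable_comp computable_listed (F := fun q : nat * nat * nat * nat =>
    (q.1.1.1, q.1.1.2, q.2))).
  by computability.
apply: computableq_lt; last by apply: computableq_shrunk; computability.
apply: (computableq_comp cD (G := fun q : nat * nat * nat * nat =>
  (q.1.2, center_index q.2, q.1.1.1.+2))).
apply: computable_pair; last by computability.
apply: computable_pair; first by computability.
by apply: computable_center_index; computability.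
Qed.

Lemma computable_hit_weight : computable (fun q : nat * nat => hit_weight q.1 q.2).
Proof.
apply: (computable_sum_iota (G := fun (q : nat * nat) k => (2 ^ k * hit q.1 k q.2)%N)
  (F := fun q => q.1)); first by computability.
apply: (computable_mul (T := nat * nat * nat)); first by computability.
apply: (computable_comp computable_hit (F := fun q : nat * nat * nat =>
  (q.1.1, q.2, q.1.2))).
by computability.
Qed.

Lemma computable_cert : computableb (fun q : nat * nat => cert q.1 q.2).
Proof.
have cL : computable (fun q : nat * nat => CodeSeq.decode (center_index q.2)).
  by apply: computable_decode; apply: computable_center_index; computability.
have cS : computable (fun q : nat * nat =>
    (\sum_(l <- CodeSeq.decode (center_index q.2)) entry l 1)%N).
  apply: (computable_sum_seq (F := fun _ l => entry l 1)) => //.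
  by apply: computable_entry; computability.
apply: (computable_and (T := nat * nat)); first by computability.
apply: (computable_and (T := nat * nat)).
  apply: computable_leq; last by computability.
  apply: (computable_sum_seq (F := fun (q : nat * nat) l =>
    (entry l 1 * hit_weight q.1 (entry l 0))%N)) => //.
  apply: (computable_mul (T := nat * nat * nat)).
    by apply: computable_entry; computability.
  apply: (computable_comp computable_hit_weight (F := fun q : nat * nat * nat =>
    (q.1.1, entry q.2 0))).
  by apply: computable_pair; [computability|apply: computable_entry; computability].
apply: computableq_le; first by apply: computableq_ball_radius; computability.
by apply: computableq_exp2N; computability.
Qed.

Lemma dominating_lsc : lower_semicomputable2 dominating.
Proof.
split; first exact: dominating_ge0.
pose ok (v : seq nat) (u : nat * nat * nat) := [&& (u.1.2 < u.1.1)%N, (u.2 < u.1.1)%N,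
  listed u.1.1 u.1.2 u.2, cert u.1.1 (nth 0%N v 2) &
  8%:R * rat_of (nth 0%N v 0) < (2 ^ u.1.2)%N%:R].
(* The first disjunct treats thresholds that the constant 1 already exceeds: any pair of balls is
   then accepted. In the second, u is (n, k, b), and the measure ball listed in v is itself the
   certificate. *)
pose V v := 8%:R * rat_of (nth 0%N v 0) < 1%N%:R \/ exists u : nat * nat * nat,
  ok v u /\ @finer R X (nth 0%N v 1) (center_index u.2) (shrunk u.1.1 u.2).
have ratE r k : (8%:R * rat_of r < (2 ^ k)%N%:R) = (8 * ratr (rat_of r) < 2 ^+ k :> R).
  by rewrite -(ltr_rat R) rmorphM /= !ratr_nat natrX.
exists V.
  apply: semidec_enumerable; apply: semidec_or.
    apply: semidec_computable; apply: computableq_lt.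
      apply: computableq_mul; apply: computableq_nat || apply: computableq_rat_of.
        by computability.
      by apply: computable_nth; computability.
    by apply: computableq_nat; computability.
  apply: (semidec_ex (A := fun v u => ok v u /\
    @finer R X (nth 0%N v 1) (center_index u.2) (shrunk u.1.1 u.2))).
  have c0 i : computable (fun q : seq nat * (nat * nat * nat) => nth 0%N q.1 i).
    by apply: computable_nth; computability.
  apply: semidec_and.
    apply: semidec_computable.
    have c1 : computableb (fun q : seq nat * (nat * nat * nat) =>
        listed q.2.1.1 q.2.1.2 q.2.2).
      by apply: (computable_comp computable_listed); computability.
    have c2 : computableb (fun q : seq nat * (nat * nat * nat) =>
        cert q.2.1.1 (nth 0%N q.1 2)).
      apply: (computable_comp computable_cert (F := fun q : seq nat * (nat * nat * nat) =>
        (q.2.1.1, nth 0%N q.1 2))).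
      by apply: computable_pair => //; computability.
    have c3 : computableb (fun q : seq nat * (nat * nat * nat) =>
        8%:R * rat_of (nth 0%N q.1 0) < (2 ^ q.2.1.2)%N%:R).
      apply: computableq_lt; last by apply: computableq_nat; computability.
      apply: computableq_mul; last exact: computableq_rat_of.
      by apply: computableq_nat; computability.
    by rewrite /ok; computability.
  apply: semidec_mdist_lt; first exact/computable_center_index/c0.
    by apply: computable_center_index; computability.
  apply: computableq_add; first by apply: computableq_shrunk; computability.
  exact/computableq_opp/computableq_ball_radius/c0.
move=> r; apply/seteqP; split=> -[x P].
  rewrite /= /dominating lte_eighth ?dominating_sup_ge1// => /ereal_sup_gtP[y [-> r1|]].
    have [n nx _] := @ball_refine R X x [::] (fun _ => ltac:(done)).
    have [j _ jP] := ideal_measure_dense P (@ltr01 R).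
    have [m mP] : exists m, basic_ball (@ideal_measure R X) m P.
      exists (CodeSeq.code [:: j; CodeSeq.code [:: 0; 0]%N]); apply/basic_ball_measureP.
      rewrite /center_index /ball_radius /posrat_of !entry_code.
      by rewrite [nth _ _ 0]/= divr1 ratr_nat.
    by exists (n, m) => //; left; rewrite /= (ratE r 0%N) expr0 -lte_fin.
  move=> [k [n [m [kn cm mP [b [bn lb bx]] ->]]]]; rewrite lte_fin => rk.
  have [|b' b'x fb] := @ball_refine R X x [:: (center_index b, shrunk n b)].
    by move=> q; rewrite inE => /eqP->.
  exists (b', m) => //; right; exists (n, k, b); split.
    by rewrite /ok /= kn bn lb cm ratE rk.
  by have := fb _ (mem_head _ _).
move=> [[b' m] /= Vv [/= b'x mP]]; rewrite /dominating lte_eighth ?dominating_sup_ge1//.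
case: Vv => [|[[[n k] b] [/and5P[/= kn bn lb cm rk] fb]]].
  rewrite /= (ratE r 0%N) expr0 -lte_fin => r1.
  exact: lt_le_trans r1 (dominating_sup_ge1 _ _).
apply: (@lt_le_trans _ _ (2 ^+ k)%:E); first by rewrite lte_fin -ratE.
apply: ereal_sup_ubound; right; exists k, n, m; split=> //.
by exists b; split=> //; exact: finer_sub fb b'x.
Qed.

(** P ranges over all measures: outside C there may be fewer certified stages, but those that occur
    are sound, and trimming carries their bound 4 over to the supremum. *)
Lemma dominating_integral (P : pmeas X) :
  (\int[P]_x (dominating : borel X -> pmeas X -> \bar R) x P <= 1)%E.
Proof.
pose S n := exists2 m, cert n m & basic_ball (@ideal_measure R X) m P.
have [|||||G [mG G0 SG Gint]] :=
  @integral_sup_trimmed _ _ _ P stage_sum S 4%:E.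
- exact: stage_sum_measurable.
- exact: stage_sum_ge0.
- exact: stage_sum_mono.
- by rewrite lee_fin.
- by move=> n [m cm mP]; exact: cert_sound cm mP.
have dG x : (dominating x P <= 8^-1%:E * (1 + G x))%E.
  rewrite lee_pmul2l// ?lte_fin ?invr_gt0//; apply: ge_ereal_sup => y [->|].
    by rewrite leeDl.
  move=> [k [n [m [kn cm mP xst ->]]]]; apply: (@le_trans _ _ (G x)); last by rewrite leeDr.
  apply: le_trans (SG n x _); last by exists m.
  rewrite /stage_sum (bigD1 (Ordinal kn)) //= indicE mem_set// mule1 leeDl//.
  by apply: sume_ge0 => i _; rewrite mule_ge0// lee_fin ?exprn_ge0.
have m1G : measurable_fun [set: borel X] (fun x => 1 + G x)%E.
  by apply: emeasurable_funD => //; exact: measurable_cst.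
apply: (@le_trans _ _ (\int[P]_x (8^-1%:E * (1 + G x)))%E).
  apply: ge0_le_integral => //.
  - by move=> x _; exact: dominating_ge0.
  - exact: lsc2_section dominating_lsc.
  - exact: measurable_funeM.
rewrite ge0_integralZl_EFin//; last by move=> x _; rewrite adde_ge0.
rewrite ge0_integralD//.
have -> : (\int[P]_x 1 = 1 :> \bar R)%E.
  by rewrite (integral_cst P measurableT 1%E) mul1e; exact: probability_setT.
apply: (@le_trans _ _ (8^-1%:E * (1 + 4%:E))%E).
  by rewrite lee_pmul2l// ?lte_fin ?invr_gt0// leeD2l.
by rewrite -EFinD -EFinM lee_fin; lra.
Qed.

End uniform_of_class.

(** * Comparison of class tests and uniform tests *)

Section comparison.
Context (R : realType) (X : constructiveMetricType R) (C : set (pmeas X)).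
Local Open Scope ereal_scope.

Lemma class_test_dominated (tC : X -> \bar R) : class_test C tC ->
  exists2 t : X -> pmeas X -> \bar R, uniform_test t &
    forall (P : pmeas X) x, C P -> tC x <= 16%:E * t x P.
Proof.
move=> [ltC tC_int]; have [tC0 [W eW WE]] := ltC.
have [p cp pW] := enumerable_semidec eW.
have [D cD DP] := @mdist_approx R X.
have mtC := lsc1_measurable ltC.
exists (dominating p D); first split.
- exact: dominating_lsc.
- exact: dominating_integral.
- by move=> P x CP; apply: (dominating_ub tC0 tC_int mtC WE pW DP).
Qed.

(** For P in C the infimum is at most the value at P, and the maximum at most the sum, whose
    integral is at most 2; this is the origin of the factor 1/2. *)
Lemma half_inf_class_test (s t : X -> pmeas X -> \bar R) :
  effectively_compact C -> uniform_test s -> uniform_test t ->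
  class_test C (half_inf C (fun x P => maxe (t x P) (s x P))).
Proof.
move=> ecC [ls s1] [lt t1].
have lst := lsc2_max lt ls.
have lh := half_inf_lsc ecC lst.
split=> // P CP; have [s0 _] := ls; have [t0 _] := lt.
have ms := lsc2_section P ls; have mt := lsc2_section P lt.
have mst : measurable_fun [set: borel X] (fun x : borel X => t x P + s x P).
  exact: emeasurable_funD.
apply: (@le_trans _ _ (\int[P]_x (2^-1%:E * ((t : borel X -> _) x P + (s : borel X -> _) x P)))).
  have [h0 _] := lh; have mh := lsc1_measurable lh.
  have m2 : measurable_fun [set: borel X]
      (fun x : borel X => 2^-1%:E * (t x P + s x P)) by exact: measurable_funeM.
  apply: ge0_le_integral => //.
  move=> x _; rewrite lee_pmul2l// ?lte_fin//.
  apply: (@le_trans _ _ (maxe (t x P) (s x P))).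
    by apply: ereal_inf_lbound; exists P.
  by rewrite ge_max leeDl//= leeDr.
rewrite ge0_integralZl_EFin//; last by move=> x _; rewrite adde_ge0.
rewrite ge0_integralD//.
apply: (@le_trans _ _ (2^-1%:E * (1 + 1))).
  by rewrite lee_pmul2l ?lte_fin//; apply: leeD; [exact: t1|exact: s1].
by rewrite -EFinD -EFinM lee_fin; lra.
Qed.

(* If [s x P] is finite, then [s x Q] is infinite for the other [Q] in [C], and
   the infimum is attained at [P]. *)
Lemma half_inf_ge (s t : X -> pmeas X -> \bar R) (P : pmeas X) x :
  lower_semicomputable2 t -> test_separator C s -> C P -> s x P != +oo ->
  t x P <= 2%:E * half_inf C (fun x P => maxe (t x P) (s x P)) x.
Proof.
move=> lt [ls _ sep] CP sP; rewrite /half_inf muleA -EFinM divff// mul1e.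
apply: le_ereal_inf_tmp => _ [Q CQ <-].
have [PQ|nPQ] := pselect (measure_eq P Q).
  by rewrite -(lsc2_measure_eq x lt PQ) le_max lexx.
have [sPoo|->] := sep P Q CP CQ nPQ x; first by rewrite sPoo eqxx in sP.
by rewrite le_max leey orbT.
Qed.

End comparison.

Local Open Scope ereal_scope.

Theorem theorem30 (R : realType) (X : constructiveMetricType R)
    (C : set (pmeas X)) (tC : X -> \bar R) (s t : X -> pmeas X -> \bar R) :
  effectively_compact C ->
  effectively_orthogonal t C ->
  universal_class_test C tC ->
  test_separator C s ->
  universal_uniform_test t ->
  exists c1 c2 : R, [/\ (0 < c1)%R, (0 < c2)%R &
    forall (P : pmeas X) (x : X), C P ->
      c1%:E * maxe (tC x) (s x P) <= t x P /\
      t x P <= c2%:E * maxe (tC x) (s x P)].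
Proof.
move=> ecC _ [class_tC univ_tC] sep_s [unif_t univ_t].
have unif_s : uniform_test s by case: sep_s.
have [t' unif_t' tCt'] := class_test_dominated class_tC.
have [cs cs0 st] := univ_t _ unif_s.
have [cd cd0 t't] := univ_t _ unif_t'.
have [cu cu0 inf_tC] := univ_tC _ (half_inf_class_test ecC unif_s unif_t).
have [lsc_t _] := unif_t; have [t0 _] := lsc_t.
(* The sum stands in for the maximum of the two constants obtained for s and for [tC]. *)
pose K : R := (cs + 16 * cd)%R.
have K0 : (0 < K)%R by rewrite addr_gt0// mulr_gt0.
exists K^-1%R, (2 * cu)%R; split; [by rewrite invr_gt0|by rewrite mulr_gt0|].
move=> P x CP; split.
  rewrite lee_pdivrMl// ge_max; apply/andP; split.
    apply: (le_trans (tCt' P x CP)).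
    apply: (@le_trans _ _ ((16 * cd)%:E * t x P)).
      by rewrite EFinM -muleA lee_pmul2l// lte_fin.
    by apply: lee_wpmul2r => //; rewrite lee_fin lerDr ltW.
  apply: (le_trans (st x P)); apply: lee_wpmul2r => //.
  by rewrite lee_fin lerDl mulr_ge0// ltW.
have [sP|sP] := eqVneq (s x P) +oo.
  by rewrite sP maxey gt0_muley ?leey// lte_fin mulr_gt0.
apply: (le_trans (half_inf_ge lsc_t sep_s CP sP)).
rewrite EFinM -muleA lee_pmul2l// ?lte_fin//.
apply: (le_trans (inf_tC x)); rewrite lee_pmul2l// ?lte_fin//.
by rewrite le_max lexx.
Qed.
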